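(* Let $(E,\|\cdot\|)$ be a complete RN module with base $(\Omega,\mathcal F,P)$ such that $E$ has full support, let $\Phi$ be a real-valued Young function, and let $|\cdot|_\Phi$ be either the Luxemburg norm $|\cdot|_{\Phi L}$ or the Orlicz norm $|\cdot|_{\Phi O}$ on $L^\Phi$, with $\|\cdot\|_\Phi$ the corresponding induced norm on $L^\Phi(E)$. Then $(L^\Phi(E),\|\cdot\|_\Phi)$ is uniformly convex if and only if $(L^\Phi,|\cdot|_\Phi)$ is uniformly convex and $(E,\|\cdot\|)$ is random uniformly convex.
   Context: Let $(\Omega,\mathcal F,P)$ be a probability space and $K=\mathbb R$ or $\mathbb C$. $L^0(\mathcal F,K)$ is the algebra of equivalence classes (under a.s. equality) of $\mathcal F$-measurable $K$-valued random variables; $L^0=L^0(\mathcal F,\mathbb R)$ is ordered by $\xi\leqslant\eta$ iff $\xi\le\eta$ a.s.; $L^0_+=\{\xi\in L^0:\xi\geqslant 0\}$. $\mathbb E$ denotes expectation with respect to $P$. Measurable sets are identified when they differ by a $P$-null set, $\tilde{\mathcal F}$ is the set of such classes, $I_D$ is the class of the indicator of $D$, inclusions are up to null sets, and $[\xi\ne0]$ etc. is the class of $\{\omega:\xi(\omega)\neq0\}$. A random normed module (RN module) over $K$ with base $(\Omega,\mathcal F,P)$ is a left module $E$ over $L^0(\mathcal F,K)$ with a map $\|\cdot\|:E\to L^0_+$ such that (1) $\|x\|=0$ iff $x=\theta$ (the null element); (2) $\|\xi x\|=|\xi|\,\|x\|$ for all $\xi\in L^0(\mathcal F,K)$, $x\in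 E$; (3) $\|x_1+x_2\|\leqslant\|x_1\|+\|x_2\|$. $E$ carries the $(\varepsilon,\lambda)$-topology, the metrizable linear topology in which $x_n\to x$ iff $\|x_n-x\|\to 0$ in probability; completeness of $E$ is with respect to it. $E$ has full support if $[\xi(E)\neq0]=\Omega$ up to a null set, where $\xi(E)=\vee\{\|x\|:x\in E\}$ (essential supremum). A Young function is a convex, left-continuous $\Phi:[0,\infty)\to[0,\infty]$ with $\lim_{t\to0}\Phi(t)=\Phi(0)=0$ and $\lim_{t\to\infty}\Phi(t)=\infty$. Its conjugate is $\Psi(s)=\sup_{t\ge0}\{ts-\Phi(t)\}$, also a Young function (possibly taking the value $\infty$). $L^\Phi=\{\xi\in L^0:\mathbb E[\Phi(c|\xi|)]<\infty\text{ for some }c>0\}$, and $L^\Psi$ similarly. Luxemburg norm: $|\xi|_{\Phi L}=\inf\{\lambda>0:\mathbb E[\Phi(|\xi|/\lambda)]\le1\}$, and $|\cdot|_{\Psi L}$ similarly. Orlicz norm: $|\xi|_{\Phi O}=\sup\{|\mathbb E[\xi\eta]|:\eta\in L^\Psi,|\eta|_{\Psi L}\le1\}$. $L^\Phi(E)=\{x\in E:\|x\|\in L^\Phi\}$ with induced norm $\|x\|_\Phi=\big|\|x\|\big|_\Phi$. A normed space $X$ is uniformly convex if for every $\epsilon\in(0,2]$ there is $\delta(\epsilon)>0$ such that $\|\frac{x+y}2\|\le1-\delta(\epsilon)$ for any $x,y\in X$ with $\|x\|=\|y\|=1$ and $\|x-y\|\ge\epsilon$. For $x,y\in E$ put $A_x=[\|x\|\ne0]$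 and $B_{xy}=A_x\cap A_y\cap A_{x-y}$. The random unit sphere is $S(E)=\{x\in E:x\ne\theta,\ \|I_{A_x}x\|=I_{A_x}\}$. Let $L_\#=\{\xi\in L^0_+:\exists\lambda\in\mathbb R,\lambda>0,\ \xi\geqslant\lambda\}$, $L_\#[0,1]=\{\xi\in L_\#:\xi\leqslant1\}$, $L_\#[0,2]=\{\xi\in L_\#:\xi\leqslant2\}$. $E$ is random uniformly convex if for any $\epsilon\in L_\#[0,2]$ there is $\delta\in L_\#[0,1]$ such that for any $x,y\in S(E)$ and any $D\in\tilde{\mathcal F}$ with $D\subset B_{xy}$ and $P(D)>0$: $I_D\|x-y\|\geqslant\epsilon I_D$ implies $I_D\|\frac{x+y}2\|\leqslant(1-\delta)I_D$. *)

(* Defs.v *)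
From HB Require Import structures.
From mathcomp Require Import all_boot all_order all_algebra.
From mathcomp Require Import all_classical all_reals all_analysis.
From mathcomp Require Import measurable_realfun.
From mathcomp Require Import complex lra.
Set Implicit Arguments.
Unset Strict Implicit.
Unset Printing Implicit Defensive.
Import Order.TTheory GRing.Theory Num.Theory.
Import numFieldNormedType.Exports.
Local Open Scope classical_set_scope.
Local Open Scope ring_scope.
Local Open Scope quotient_scope.

Inductive scalar_kind := RealScalars | ComplexScalars.

Definition scalar_numField (R : realType) (k : scalar_kind) : numFieldType :=
  match k with RealScalars => R | ComplexScalars => R[i] end.

Definition scalar_field (R : realType) (k : scalar_kind) : Type :=
  scalar_numField R k.

HB.instance Definition _ R k :=
  Num.NumField.copy (scalar_field R k) (scalar_numField R k).
HB.instance Definition _ R k := isPointed.Build (scalar_field R k) 0.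

Local Notation RE := (@complex.Re _).
Local Notation IM := (@complex.Im _).

(* The Borel sigma-algebra of C, transported from R * R. *)
Definition complex_pair (R : realType) (z : R[i]) : R * R :=
  (RE z, IM z).

Definition scalar_measurable (R : realType) (k : scalar_kind) :
    set (set (scalar_field R k)) :=
  match k with
  | RealScalars => @measurable _ R
  | ComplexScalars => preimage_set_system setT (@complex_pair R) measurable
  end.

Section scalar_sigma_algebra.
Variables (R : realType) (k : scalar_kind).

Let sigma_scalar : sigma_algebra setT (@scalar_measurable R k).
Proof.
have meas_sigma d (T : measurableType d) : sigma_algebra setT (@measurable _ T).
  split=> //; last exact: bigcupT_measurable.
  by move=> A mA; rewrite setTD; exact: measurableC.
case: k => /=; first exact: meas_sigma.
exact/sigma_algebra_preimage/meas_sigma.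
Qed.

Let scalar_measurable0 : scalar_measurable (set0 : set (scalar_field R k)).
Proof. by case: sigma_scalar. Qed.

Let scalar_measurableC (A : set (scalar_field R k)) :
  scalar_measurable A -> scalar_measurable (~` A).
Proof. by case: sigma_scalar => _ + _ => /[apply]; rewrite setTD. Qed.

Let scalar_measurable_bigcup (F : (set (scalar_field R k))^nat) :
  (forall i, scalar_measurable (F i)) -> scalar_measurable (\bigcup_i F i).
Proof. by case: sigma_scalar => _ _; apply. Qed.

HB.instance Definition _ := isMeasurable.Build default_measure_display
  (scalar_field R k)
  scalar_measurable0 scalar_measurableC scalar_measurable_bigcup.

End scalar_sigma_algebra.

Definition modulus (R : realType) (k : scalar_kind) : scalar_field R k -> R :=
  match k with
  | RealScalars => fun z : R => `|z|
  | ComplexScalars => fun z : R[i] => RE `|z|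
  end.

Section scalar_measurability.
Context d (T : measurableType d) (R : realType).

Lemma measurable_realP (f : T -> scalar_field R RealScalars) :
  measurable_fun setT f <-> measurable_fun setT (f : T -> R).
Proof. by split=> mf _ B mB; exact: mf. Qed.

Lemma measurable_complexP (f : T -> scalar_field R ComplexScalars) :
  measurable_fun setT f <->
  measurable_fun setT (RE \o f : T -> R) /\
  measurable_fun setT (IM \o f : T -> R).
Proof.
split=> [mf|[mre mim]].
  have mpair : measurable_fun setT (@complex_pair R \o f).
    move=> _ B mB; rewrite setTI comp_preimage -[X in measurable X]setTI.
    by apply: mf => //; exists B; rewrite ?setTI.
  by split; [exact: (measurableT_comp measurable_fst mpair)
            |exact: (measurableT_comp measurable_snd mpair)].
move=> _ A [B mB <-]; rewrite !setTI -comp_preimage -[X in measurable X]setTI.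
exact: (measurable_fun_pair mre mim).
Qed.

Variable k : scalar_kind.

Lemma measurable_scalarD (f g : T -> scalar_field R k) :
  measurable_fun setT f -> measurable_fun setT g ->
  measurable_fun setT (fun w => f w + g w).
Proof.
case: k f g => f g; first exact: measurable_funD.
move=> /measurable_complexP[f1 f2] /measurable_complexP[g1 g2].
apply/measurable_complexP; split.
- rewrite (_ : _ \o _ = (RE \o f) \+ (RE \o g)).
    exact: measurable_funD.
  by apply/funext => w /=; case: (f w); case: (g w).
- rewrite (_ : _ \o _ = (IM \o f) \+ (IM \o g)).
    exact: measurable_funD.
  by apply/funext => w /=; case: (f w); case: (g w).
Qed.

Lemma measurable_scalarM (f g : T -> scalar_field R k) :
  measurable_fun setT f -> measurable_fun setT g ->
  measurable_fun setT (fun w => f w * g w).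
Proof.
case: k f g => f g; first exact: measurable_funM.
move=> /measurable_complexP[f1 f2] /measurable_complexP[g1 g2].
apply/measurable_complexP; split.
- rewrite (_ : _ \o _ = ((RE \o f) \* (RE \o g)) \-
                        ((IM \o f) \* (IM \o g))).
    by apply: measurable_funB; exact: measurable_funM.
  by apply/funext => w /=; case: (f w); case: (g w).
- rewrite (_ : _ \o _ = ((RE \o f) \* (IM \o g)) \+
                        ((IM \o f) \* (RE \o g))).
    by apply: measurable_funD; exact: measurable_funM.
  by apply/funext => w /=; case: (f w); case: (g w).
Qed.

Lemma measurable_modulus (f : T -> scalar_field R k) :
  measurable_fun setT f -> measurable_fun setT (@modulus R k \o f).
Proof.
case: k f => f; first by move=> /measurable_realP;
  exact: (measurableT_comp (@normr_measurable R setT)).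
move=> /measurable_complexP[f1 f2].
rewrite (_ : _ \o _ = (fun w => Num.sqrt ((RE \o f) w ^+ 2 +
                                 (IM \o f) w ^+ 2))).
  apply: (@measurableT_comp _ _ _ _ _ _ (@Num.sqrt R)).
    apply: continuous_measurable_fun; exact: sqrt_continuous.
  by apply: measurable_funD; exact: measurable_funX.
by apply/funext => w /=; case: (f w).
Qed.

Lemma measurable_scalar_indic (D : set T) :
  measurable D -> measurable_fun setT (\1_D : T -> scalar_field R k).
Proof.
move=> mD; rewrite (_ : \1_D = fun w => if w \in D then 1 else 0).
  apply: measurable_fun_ifT => //; apply: (@measurable_fun_bool _ _ _ _ true).
  by rewrite setTI (_ : _ @^-1` _ = D)//; apply/seteqP; split => w /=;
    [exact: set_mem|exact: mem_set].
by apply/funext => w; rewrite indicE; case: (w \in D).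
Qed.

End scalar_measurability.

Section random_variables.
Context d (T : measurableType d) (R : realType) (P : probability T R).

(* Almost sure classes of K-valued random variables; a class is evaluated
   through a chosen representative. *)
Definition L0 (k : scalar_kind) : Type := {mfun_ P, T >-> scalar_field R k}.

Section operations.
Variable k : scalar_kind.
Local Notation L0 := (L0 k).

HB.instance Definition _ := Choice.on L0.

Definition L0_fun (xi : L0) : T -> scalar_field R k := aqEqMfun_to_fun xi.
Coercion L0_fun : L0 >-> Funclass.

Lemma measurable_L0 (xi : L0) : measurable_fun setT xi.
Proof. exact: measurable_funPT. Qed.

Definition mfun_of (f : T -> scalar_field R k) (mf : measurable_fun setT f) :
    {mfun T >-> scalar_field R k} :=
  HB.pack_for {mfun T >-> scalar_field R k} f
    (isMeasurableFun.Build _ _ _ _ f mf).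

Definition L0_class (f : T -> scalar_field R k)
    (mf : measurable_fun setT f) : L0 :=
  \pi_{mfun_ P, T >-> scalar_field R k} (mfun_of mf).

Lemma L0_classE f (mf : measurable_fun setT f) :
  \forall w \ae P, L0_class mf w = f w.
Proof.
have /eqmodP/asboolP : mfun_of mf = repr (L0_class mf)
  %[mod {mfun_ P, T >-> scalar_field R k}] by rewrite reprK.
by apply: filterS => w /(_ Logic.I) /= ->.
Qed.

Lemma L0P (xi eta : L0) : (\forall w \ae P, xi w = eta w) <-> xi = eta.
Proof.
split=> [xieta|->]; last exact: aeW.
rewrite -[xi]reprK -[eta]reprK; apply/eqmodP/asboolP.
by apply: filterS xieta => w + _.
Qed.

Definition L0_add (xi eta : L0) : L0 :=
  L0_class (measurable_scalarD (measurable_L0 xi) (measurable_L0 eta)).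
Definition L0_mul (xi eta : L0) : L0 :=
  L0_class (measurable_scalarM (measurable_L0 xi) (measurable_L0 eta)).
Definition L0_const (a : scalar_field R k) : L0 :=
  L0_class (measurable_cst a).
Definition L0_opp (xi : L0) : L0 := L0_mul (L0_const (- 1)) xi.

Lemma L0_addE xi eta : \forall w \ae P, L0_add xi eta w = xi w + eta w.
Proof. exact: L0_classE. Qed.
Lemma L0_mulE xi eta : \forall w \ae P, L0_mul xi eta w = xi w * eta w.
Proof. exact: L0_classE. Qed.
Lemma L0_constE a : \forall w \ae P, L0_const a w = a.
Proof. exact: L0_classE. Qed.
Lemma L0_oppE xi : \forall w \ae P, L0_opp xi w = - xi w.
Proof.
apply: filterS2 (L0_mulE (L0_const (-1)) xi) (L0_constE (-1)) => w -> ->.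
by rewrite mulN1r.
Qed.

Local Ltac L0_ae w := apply/L0P; near=> w; repeat match goal with
  | |- context [L0_fun (L0_add ?x ?y) w] =>
    have -> : L0_add x y w = x w + y w by near: w; exact: L0_addE
  | |- context [L0_fun (L0_mul ?x ?y) w] =>
    have -> : L0_mul x y w = x w * y w by near: w; exact: L0_mulE
  | |- context [L0_fun (L0_opp ?x) w] =>
    have -> : L0_opp x w = - x w by near: w; exact: L0_oppE
  | |- context [L0_fun (L0_const ?a) w] =>
    have -> : L0_const a w = a by near: w; exact: L0_constE
  end.

Let addA : associative L0_add.
Proof.
by move=> x y z; L0_ae w; exact: addrA. Unshelve. all: by end_near. Qed.

Let addC : commutative L0_add.
Proof. by move=> x y; L0_ae w; exact: addrC. Unshelve. all: by end_near. Qed.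

Let add0 : left_id (L0_const 0) L0_add.
Proof. by move=> x; L0_ae w; exact: add0r. Unshelve. all: by end_near. Qed.

Let addN : left_inverse (L0_const 0) L0_opp L0_add.
Proof. by move=> x; L0_ae w; exact: addNr. Unshelve. all: by end_near. Qed.

HB.instance Definition _ := GRing.isZmodule.Build L0 addA addC add0 addN.

Let mulA : associative L0_mul.
Proof. by move=> x y z; L0_ae w; exact: mulrA. Unshelve. all: by end_near. Qed.

Let mulC : commutative L0_mul.
Proof. by move=> x y; L0_ae w; exact: mulrC. Unshelve. all: by end_near. Qed.

Let mul1 : left_id (L0_const 1) L0_mul.
Proof. by move=> x; L0_ae w; exact: mul1r. Unshelve. all: by end_near. Qed.

Let mulD : left_distributive L0_mul L0_add.
Proof. by move=> x y z; L0_ae w; exact: mulrDl. Unshelve. all: by end_near. Qed.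

Let one_neq0 : L0_const 1 != 0 :> L0.
Proof.
apply/eqP => /L0P e10.
have Pfalse : \forall w \ae P, False.
  apply: filterS3 e10 (L0_constE 1) (L0_constE 0) => w + w1 w0.
  by rewrite w1 [RHS]w0; apply/eqP/oner_neq0.
have /(negligibleP P measurableT)/eqP : P.-negligible setT.
  by apply: negligibleS Pfalse => w _.
by rewrite [X in X == _](_ : _ = 1%E) ?onee_eq0//; exact: probability_setT.
Qed.

HB.instance Definition _ :=
  GRing.Zmodule_isComNzRing.Build L0 mulA mulC mul1 mulD one_neq0.

Definition L0_scale (a : scalar_field R k) (xi : L0) : L0 :=
  L0_mul (L0_const a) xi.

Let scaleA a b (xi : L0) : L0_scale a (L0_scale b xi) = L0_scale (a * b) xi.
Proof.
by rewrite /L0_scale; L0_ae w; exact: mulrA. Unshelve. all: by end_near. Qed.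

Let scale1 : left_id 1 L0_scale.
Proof. exact: mul1. Qed.

Let scaleDr : right_distributive L0_scale +%R.
Proof. by move=> a x y; exact: mulrDr. Qed.

Let scaleDl (xi : L0) : {morph L0_scale^~ xi : a b / a + b}.
Proof.
move=> a b; rewrite /L0_scale -[RHS]/(L0_add _ _).
by L0_ae w; exact: mulrDl. Unshelve. all: by end_near. Qed.

HB.instance Definition _ :=
  GRing.Zmodule_isLmodule.Build (scalar_field R k) L0
    scaleA scale1 scaleDr scaleDl.

Let scaleAl (a : scalar_field R k) (x y : L0) : a *: (x * y) = a *: x * y.
Proof. exact: mulA. Qed.

HB.instance Definition _ :=
  GRing.Lmodule_isLalgebra.Build (scalar_field R k) L0 scaleAl.

Definition L0_indic (D : set T) (mD : measurable D) : L0 :=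
  L0_class (measurable_scalar_indic mD).

End operations.

(* A copy of L0 RealScalars whose elements coerce to functions into R itself
   and which carries the almost sure order. *)
Definition realL0 : Type := L0 RealScalars.

HB.instance Definition _ := GRing.ComNzRing.copy realL0 (L0 RealScalars).
HB.instance Definition _ :=
  GRing.Lalgebra.copy realL0 (L0 RealScalars).


Definition realL0_fun (xi : realL0) : T -> R := L0_fun xi.
Coercion realL0_fun : realL0 >-> Funclass.

Lemma measurable_realL0 (xi : realL0) : measurable_fun setT xi.
Proof.
exact: (measurable_realP (L0_fun xi)).1 (@measurable_L0 RealScalars xi).
Qed.

Lemma realL0P (xi eta : realL0) :
  (\forall w \ae P, xi w = eta w) <-> xi = eta.
Proof. exact: (@L0P RealScalars). Qed.

Definition realL0_le (xi eta : realL0) : bool :=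
  `[< \forall w \ae P, xi w <= eta w >].

Let realL0_le_refl : reflexive realL0_le.
Proof. by move=> xi; apply/asboolP/aeW. Qed.

Let realL0_le_anti : antisymmetric realL0_le.
Proof.
move=> xi eta /andP[/asboolP xe /asboolP ex]; apply/realL0P.
by apply: filterS2 xe ex => w; lra.
Qed.

Let realL0_le_trans : transitive realL0_le.
Proof.
move=> eta xi zeta /asboolP xe /asboolP ez; apply/asboolP.
by apply: filterS2 xe ez => w; exact: le_trans.
Qed.

HB.instance Definition _ := Order.Le_isPOrder.Build ring_display realL0
  realL0_le_refl realL0_le_anti realL0_le_trans.

Lemma realL0_leP (xi eta : realL0) :
  xi <= eta <-> \forall w \ae P, xi w <= eta w.
Proof. by split=> /asboolP. Qed.

Definition L0_modulus k (xi : L0 k) : realL0 :=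
  @L0_class RealScalars _
    ((measurable_realP _).2 (measurable_modulus (measurable_L0 xi))).

Definition nonzero (xi : realL0) : set T := [set w | xi w != 0].

Lemma measurable_nonzero (xi : realL0) : measurable (nonzero xi).
Proof.
rewrite (_ : nonzero xi = ~` (xi @^-1` [set 0])).
  by apply: measurableC; rewrite -[X in measurable X]setTI;
    exact: measurable_realL0.
by apply/seteqP; split=> w /= /eqP.
Qed.

Definition realL0_indic (D : set T) (mD : measurable D) : realL0 :=
  L0_indic RealScalars mD.

End random_variables.

HB.mixin Record isRNModule d (T : measurableType d) (R : realType)
    (P : probability T R) (k : scalar_kind) E
    & GRing.Lmodule (L0 P k) E := {
  rnorm : E -> realL0 P;
  rnorm_ge0 : forall x, 0 <= rnorm x;
  rnorm_eq0 : forall x, rnorm x = 0 <-> x = 0;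
  rnormZ : forall (xi : L0 P k) x, rnorm (xi *: x) = L0_modulus xi * rnorm x;
  ler_rnormD : forall x y, rnorm (x + y) <= rnorm x + rnorm y
}.

#[short(type="rnModType")]
HB.structure Definition RNModule d (T : measurableType d) (R : realType)
    (P : probability T R) (k : scalar_kind) :=
  {E of isRNModule d T R P k E & GRing.Lmodule (L0 P k) E}.

Section restriction_of_scalars.
Context d (T : measurableType d) (R : realType) (P : probability T R).
Context (k : scalar_kind) (E : lmodType (L0 P k)).

(* E as a vector space over K: a in K acts as the constant class a%:A. *)
Definition restrict_scalars : Type := E.

HB.instance Definition _ := GRing.Zmodule.on restrict_scalars.

Definition restrict_scale (a : scalar_field R k) (x : restrict_scalars) :
  restrict_scalars := (a%:A : L0 P k) *: (x : E).

Let scaleA a b x :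
  restrict_scale a (restrict_scale b x) = restrict_scale (a * b) x.
Proof. by rewrite /restrict_scale scalerA -scalerAl mul1r scalerA. Qed.

Let scale1 : left_id 1 restrict_scale.
Proof. by move=> x; rewrite /restrict_scale scale1r; exact: scale1r. Qed.

Let scaleDr : right_distributive restrict_scale +%R.
Proof. by move=> a x y; exact: scalerDr. Qed.

Let scaleDl x : {morph restrict_scale^~ x : a b / a + b}.
Proof.
by move=> a b; rewrite /restrict_scale scalerDl; exact: scalerDl.
Qed.

HB.instance Definition _ := GRing.Zmodule_isLmodule.Build (scalar_field R k)
  restrict_scalars scaleA scale1 scaleDr scaleDl.

End restriction_of_scalars.

Section rn_module.
Context d (T : measurableType d) (R : realType) (P : probability T R).
Context (k : scalar_kind) (E : rnModType P k).

Definition cvg_in_probability (x : E^nat) (l : E) : Prop :=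
  forall eps : R, 0 < eps ->
    P [set w | eps <= rnorm (x n - l) w] @[n --> \oo] --> 0%E.

Definition cauchy_in_probability (x : E^nat) : Prop :=
  forall eps : R, 0 < eps ->
    P [set w | eps <= rnorm (x p.1 - x p.2) w] @[p --> (\oo, \oo)] --> 0%E.

(* The (eps, lambda)-topology is a metrizable linear topology, so completeness
   is convergence of its Cauchy sequences. *)
Definition rn_complete : Prop :=
  forall x : E^nat, cauchy_in_probability x ->
    exists l, cvg_in_probability x l.

(* Essential supremum of a family, computed in the extended reals. *)
Definition is_esssup (S : set (realL0 P)) (zeta : {mfun_ P, T >-> \bar R}) :
    Prop :=
  (forall xi, S xi -> \forall w \ae P, ((xi w)%:E <= zeta w)%E) /\
  (forall zeta' : {mfun_ P, T >-> \bar R},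
     (forall xi, S xi -> \forall w \ae P, ((xi w)%:E <= zeta' w)%E) ->
     \forall w \ae P, (zeta w <= zeta' w)%E).

Definition full_support : Prop :=
  exists2 zeta : {mfun_ P, T >-> \bar R},
    is_esssup [set rnorm x | x in [set: E]] zeta &
    \forall w \ae P, zeta w != 0%E.

Definition norm_support (x : E) : set T := nonzero (rnorm x).

Definition random_unit_sphere : set E :=
  [set x | x <> 0 /\
    rnorm (L0_indic P k (measurable_nonzero (rnorm x)) *: x) =
    realL0_indic P (measurable_nonzero (rnorm x))].

Definition L_sharp : set (realL0 P) :=
  [set xi : realL0 P | 0 <= xi /\
    exists2 lam : R, 0 < lam & (lam%:A : realL0 P) <= xi].

(* D ranges over representatives: only its class modulo null sets matters. *)
Definition random_uniformly_convex : Prop :=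
  forall eps : realL0 P, L_sharp eps -> eps <= 2%:R ->
  exists delta : realL0 P, [/\ L_sharp delta, delta <= 1 &
    forall x y : E, random_unit_sphere x -> random_unit_sphere y ->
    forall (D : set T) (mD : measurable D),
      (\forall w \ae P, D w ->
        (norm_support x `&` norm_support y `&` norm_support (x - y)) w) ->
      (0 < P D)%E ->
      eps * realL0_indic P mD <= realL0_indic P mD * rnorm (x - y) ->
      realL0_indic P mD *
        rnorm (((2^-1 : scalar_field R k)%:A : L0 P k) *: (x + y)) <=
        (1 - delta) * realL0_indic P mD].

End rn_module.

(* Only the values of Phi on [0, +oo[ matter. *)
Record young_function (R : realType) (Phi : R -> \bar R) : Prop := {
  young_ge0 : forall t : R, 0 <= t -> (0 <= Phi t)%E;
  young_convex : forall s t a : R, 0 <= s -> 0 <= t -> 0 <= a <= 1 ->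
    (Phi (a * s + (1 - a) * t)%R <= a%:E * Phi s + (1 - a)%R%:E * Phi t)%E;
  young_left_continuous : forall t : R, 0 < t -> Phi s @[s --> t^'-] --> Phi t;
  young0 : Phi 0 = 0%E;
  young_cvg0 : Phi t @[t --> 0^'+] --> 0%E;
  young_cvgy : Phi t @[t --> +oo] --> +oo%E
}.

Definition young_conjugate (R : realType) (Phi : R -> \bar R) (s : R) :
    \bar R :=
  ereal_sup [set ((t * s)%R%:E - Phi t)%E | t in [set t | 0 <= t]].

Section orlicz.
Context d (T : measurableType d) (R : realType) (P : probability T R).
Variable Phi : R -> \bar R.

Definition orlicz_space : set (realL0 P) :=
  [set xi | exists2 c : R, 0 < c & (\int[P]_w Phi (c * `|xi w|)%R < +oo)%E].

(* Both norms below are finite on the Orlicz space of Phi. *)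
Definition luxemburg_norm (xi : realL0 P) : \bar R :=
  ereal_inf [set lam%:E | lam in
    [set lam : R | 0 < lam /\ (\int[P]_w Phi (`|xi w| / lam)%R <= 1)%E]].

End orlicz.

Arguments orlicz_space {d T R} P Phi.
Arguments luxemburg_norm {d T R} P Phi xi.

Definition orlicz_norm d (T : measurableType d) (R : realType)
    (P : probability T R) (Phi : R -> \bar R) (xi : realL0 P) : \bar R :=
  ereal_sup [set `| \int[P]_w (xi w * eta w)%R%:E |%E | eta in
    [set eta : realL0 P | orlicz_space P (young_conjugate Phi) eta /\
      (luxemburg_norm P (young_conjugate Phi) eta <= 1)%E]].

Arguments orlicz_norm {d T R} P Phi xi.

Section orlicz_module.
Context d (T : measurableType d) (R : realType) (P : probability T R).
Context (k : scalar_kind) (E : rnModType P k).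

Definition orlicz_module (Phi : R -> \bar R) : set (restrict_scalars E) :=
  [set x | orlicz_space P Phi (rnorm (x : E))].

Definition induced_norm (nrm : realL0 P -> \bar R) (x : restrict_scalars E) :
  \bar R := nrm (rnorm (x : E)).

End orlicz_module.

Arguments orlicz_module {d T R P k} E Phi.
Arguments induced_norm {d T R P k} E nrm x.

(* Uniform convexity of the normed space (X, nrm), X a linear subspace of V.
   The norm is extended-real-valued, like the Lp norms of the library; it is
   only considered on X, where it is finite. *)
Definition uniformly_convex (R : realType) (K : numFieldType) (V : lmodType K)
    (X : set V) (nrm : V -> \bar R) : Prop :=
  forall eps : R, 0 < eps <= 2 ->
  exists2 delta : R, 0 < delta &
    forall x y : V, X x -> X y -> nrm x = 1%E -> nrm y = 1%E ->
      (eps%:E <= nrm (x - y)%R)%E ->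
      (nrm (2^-1 *: (x + y))%R <= (1 - delta)%R%:E)%E.

(* Main.v *)
Require Import Defs.
From HB Require Import structures.
From mathcomp Require Import all_boot all_order all_algebra.
From mathcomp Require Import all_classical all_reals all_analysis.
From mathcomp Require Import measurable_realfun complex ring lra.
Set Implicit Arguments.
Unset Strict Implicit.
Unset Printing Implicit Defensive.
Import Order.TTheory GRing.Theory Num.Theory.
Import numFieldNormedType.Exports.
Local Open Scope classical_set_scope.
Local Open Scope ring_scope.

(** The two norms on the Orlicz space enter the proof only as lattice norms: they
are monotone in the modulus, subadditive, homogeneous, finite on the Orlicz space
and positive on indicators of non-null events.  The record [function_norm] states
these properties, [luxemburg_function_norm] and [orlicz_function_norm] establish
them, and the equivalence holds for any space X of random variables with such a
norm N and for the space X(E) of the vectors of E whose random norm is in X.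

Let X(E) be uniformly convex.  The space X is uniformly convex because E contains
a vector x0 of random norm 1, so that xi |-> xi x0 embeds X isometrically; this
vector is obtained by exhaustion from completeness and full support
([exists_unit_norm]).  The module E is random uniformly convex because a failure
on a non-null event D' could be localized: multiplied by 1_D' / N (1_D'), the two
vectors become unit vectors of X(E) that contradict its uniform convexity
([random_uniformly_convex_of_module]).

Conversely, let x and y be unit vectors of X(E) that are far apart, with random
norms f and g.  If f and g are far apart in X, then (f + g) / 2 has a norm well
below 1 and dominates the random norm of (x + y) / 2.  Otherwise y may be replaced
by a close vector of random norm exactly f ([exists_same_norm]).  In this case
random uniform convexity shortens the midpoint on the event D where the random
norm of x - y is at least a fixed multiple of f.  This shortening on D is turned
into a decrease of the norm by comparing f with its reflection f - 2 (1_D f), which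
has the same norm as f and is far from f, so that uniform convexity of X bounds
the norm of their midpoint, the restriction of f to the complement of D
([equal_norm_uniform_convexity]). *)

(** * Almost sure calculus of random variables *)

Lemma measurable_invr (R : realType) : measurable_fun setT (fun r : R => r^-1).
Proof.
rewrite -(setUv [set 0]); apply/measurable_funU => //.
  exact: measurableC.
split; first exact: measurable_fun_set1.
apply: open_continuous_measurable_fun.
  by apply: closed_openC; exact: closed_eq.
by move=> r /set_mem r0; apply: inv_continuous; apply/eqP.
Qed.

Lemma measurable_ge0 d (T : measurableType d) (R : realType) (f : T -> R) :
  measurable_fun setT f -> measurable [set w | 0 <= f w].
Proof.
move=> mf; rewrite (_ : [set _ | _] = f @^-1` `[0, +oo[).
  by rewrite -[X in measurable X]setTI; exact: mf.
by apply/seteqP; split => w /=; rewrite in_itv/= andbT.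
Qed.

Section almost_sure_calculus.
Context d (T : measurableType d) (R : realType) (P : probability T R).
Implicit Types xi eta : realL0 P.

(** Chaining applications of this rule collects almost sure facts about several
random variables as hypotheses at one common outcome, which is how all the
almost sure computations below are organized. *)
Lemma ae_mp (Q G : T -> Prop) : (\forall w \ae P, Q w) ->
  (\forall w \ae P, Q w -> G w) -> \forall w \ae P, G w.
Proof. by move=> q; apply: filterS2 q => w q /(_ q). Qed.

Lemma probability_ae_exists (G : T -> Prop) :
  (\forall w \ae P, G w) -> exists w, G w.
Proof.
apply: (@filter_ex _ _ (ae_properfilter_algebraOfSetsType _)).
by have := probability_setT P; move=> /= ->; rewrite lte01.
Qed.

Lemma null_set_ae (D : set T) : measurable D -> P D = 0%E ->
  \forall w \ae P, ~ D w.
Proof.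
move=> mD /(negligibleP P mD).2 h; apply: negligibleS h.
by move=> w /= /contrapT.
Qed.

Lemma ae_measure_le (A B : set T) : measurable A -> measurable B ->
  (\forall w \ae P, A w -> B w) -> (P A <= P B)%E.
Proof.
move=> mA mB h; rewrite (measureDI P mA mB).
rewrite [X in (X + _)%E](_ : _ = 0%E); last first.
  apply/(negligibleP P (measurableD mA mB)); apply: negligibleS h.
  by move=> w [Aw nB] /= /(_ Aw).
by rewrite add0e le_measure ?inE//; exact: measurableI.
Qed.

Definition realL0_class (f : T -> R) (mf : measurable_fun setT f) : realL0 P :=
  @L0_class _ _ _ P RealScalars f ((measurable_realP _).2 mf).

Lemma realL0_classE f (mf : measurable_fun setT f) :
  \forall w \ae P, realL0_class mf w = f w.
Proof. exact: (@L0_classE _ _ _ P RealScalars). Qed.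

Lemma realL0_addE xi eta : \forall w \ae P, (xi + eta : realL0 P) w = xi w + eta w.
Proof. exact: (@L0_addE _ _ _ P RealScalars). Qed.

Lemma realL0_oppE xi : \forall w \ae P, (- xi : realL0 P) w = - xi w.
Proof. exact: (@L0_oppE _ _ _ P RealScalars). Qed.

Lemma realL0_subE xi eta : \forall w \ae P, (xi - eta : realL0 P) w = xi w - eta w.
Proof. by apply: filterS2 (realL0_addE xi (- eta)) (realL0_oppE eta) => w -> ->. Qed.

Lemma realL0_mulE xi eta : \forall w \ae P, (xi * eta : realL0 P) w = xi w * eta w.
Proof. exact: (@L0_mulE _ _ _ P RealScalars). Qed.

Lemma realL0_0E : \forall w \ae P, (0 : realL0 P) w = 0.
Proof. exact: (@L0_constE _ _ _ P RealScalars). Qed.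

Lemma realL0_1E : \forall w \ae P, (1 : realL0 P) w = 1.
Proof. exact: (@L0_constE _ _ _ P RealScalars). Qed.

Lemma realL0_scaleE (a : R) xi : \forall w \ae P, (a *: xi : realL0 P) w = a * xi w.
Proof.
have h1 : \forall w \ae P, (a *: xi : realL0 P) w =
    realL0_fun (@L0_const _ _ _ P RealScalars a) w * xi w.
  exact: (@L0_mulE _ _ _ P RealScalars).
have h2 : \forall w \ae P, realL0_fun (@L0_const _ _ _ P RealScalars a) w = a.
  exact: (@L0_constE _ _ _ P RealScalars).
by apply: filterS2 h1 h2 => w -> ->.
Qed.

Lemma realL0_constE (a : R) : \forall w \ae P, (a%:A : realL0 P) w = a.
Proof.
by apply: filterS2 (realL0_scaleE a 1) realL0_1E => w -> ->; rewrite mulr1.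
Qed.

Lemma realL0_indicE (D : set T) (mD : measurable D) :
  \forall w \ae P, realL0_indic P mD w = \1_D w.
Proof. exact: (@L0_classE _ _ _ P RealScalars). Qed.

Lemma measurable_abs xi : measurable_fun setT (fun w => `|xi w|).
Proof.
exact: (measurableT_comp (@normr_measurable R setT) (measurable_realL0 xi)).
Qed.

Lemma measurable_recip xi : measurable_fun setT (fun w => (xi w)^-1).
Proof. exact: (measurableT_comp (@measurable_invr R) (measurable_realL0 xi)). Qed.

Definition recip xi : realL0 P := realL0_class (measurable_recip xi).

Lemma recipE xi : \forall w \ae P, recip xi w = (xi w)^-1.
Proof. exact: realL0_classE. Qed.

(** A real random variable must act on a module whose scalars may be complex;
it does so through the inclusion of the reals into the scalar field. *)
Definition real_scalar k : R -> scalar_field R k :=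
  match k with RealScalars => id | ComplexScalars => real_complex R end.

Lemma measurable_real_scalar k (f : T -> R) : measurable_fun setT f ->
  measurable_fun setT (@real_scalar k \o f).
Proof.
case: k => mf; first exact/measurable_realP.
apply/measurable_complexP; split; first exact: mf.
exact: measurable_cst.
Qed.

Definition embed k xi : L0 P k :=
  L0_class P (@measurable_real_scalar k xi (measurable_realL0 xi)).

Lemma embedE k xi : \forall w \ae P, embed k xi w = real_scalar k (xi w).
Proof. exact: L0_classE. Qed.

Lemma modulus_real_scalar k (r : R) : modulus (real_scalar k r) = `|r|.
Proof. by case: k => //=; rewrite expr0n addr0 sqrtr_sqr. Qed.

Lemma L0_modulusE k (z : L0 P k) : \forall w \ae P, L0_modulus z w = modulus (z w).
Proof. exact: (@L0_classE _ _ _ P RealScalars). Qed.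

Lemma embedB k xi eta : embed k (xi - eta) = embed k xi - embed k eta.
Proof.
apply/L0P.
have h : \forall w \ae P, (embed k xi - embed k eta : L0 P k) w =
    embed k xi w - embed k eta w.
  by apply: filterS2 (L0_addE (embed k xi) (L0_opp (embed k eta)))
    (L0_oppE (embed k eta)) => w + e; rewrite -e.
apply: ae_mp h _; apply: ae_mp (embedE k xi) _; apply: ae_mp (embedE k eta) _.
apply: ae_mp (embedE k (xi - eta)) _; apply: ae_mp (realL0_subE xi eta) _.
apply: aeW => w -> -> -> -> ->.
by case: k => //=; rewrite rmorphB.
Qed.

Lemma embed1 k : embed k 1 = 1.
Proof.
apply/L0P.
have h : \forall w \ae P, (1 : L0 P k) w = 1 by exact: L0_constE.
apply: ae_mp h _; apply: ae_mp (embedE k 1) _; apply: ae_mp realL0_1E _.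
by apply: aeW => w -> -> ->; case: k.
Qed.

Lemma embed0 k : embed k 0 = 0.
Proof. by rewrite -(subrr 1) embedB subrr. Qed.

Lemma embedN k xi : embed k (- xi) = - embed k xi.
Proof. by rewrite -sub0r embedB embed0 sub0r. Qed.

Lemma embedD k xi eta : embed k (xi + eta) = embed k xi + embed k eta.
Proof. by rewrite -[eta in LHS]opprK embedB embedN opprK. Qed.

End almost_sure_calculus.

(** * The random norm *)

Section rn_calculus.
Context d (T : measurableType d) (R : realType) (P : probability T R).
Context (k : scalar_kind) (E : rnModType P k).
Implicit Types (x y : E) (xi : realL0 P).

Lemma rnorm_pos x : \forall w \ae P, 0 <= rnorm x w.
Proof.
have /realL0_leP h := rnorm_ge0 x; apply: ae_mp h _.
by apply: ae_mp (realL0_0E P) _; apply: aeW => w ->.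
Qed.

Lemma rnormZE (z : L0 P k) x :
  \forall w \ae P, rnorm (z *: x) w = modulus (z w) * rnorm x w.
Proof.
rewrite rnormZ; apply: ae_mp (realL0_mulE (L0_modulus z) (rnorm x)) _.
by apply: ae_mp (L0_modulusE z) _; apply: aeW => w -> ->.
Qed.

Lemma rnorm_embed xi x : \forall w \ae P, rnorm (embed k xi *: x) w = `|xi w| * rnorm x w.
Proof.
apply: ae_mp (rnormZE (embed k xi) x) _; apply: ae_mp (embedE k xi) _.
by apply: aeW => w -> ->; rewrite modulus_real_scalar.
Qed.

Lemma rnorm_indic (D : set T) (mD : measurable D) x :
  \forall w \ae P, rnorm (L0_indic P k mD *: x) w = \1_D w * rnorm x w.
Proof.
apply: ae_mp (rnormZE (L0_indic P k mD) x) _.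
have h : \forall w \ae P, L0_indic P k mD w = \1_D w by exact: L0_classE.
apply: ae_mp h _; apply: aeW => w -> ->; rewrite !indicE; congr (_ * _).
by rewrite -[RHS]normr_nat -(modulus_real_scalar k); case: (_ \in _); case: k.
Qed.

Lemma rnorm_triangle x y : \forall w \ae P, rnorm (x + y) w <= rnorm x w + rnorm y w.
Proof.
have /realL0_leP h := ler_rnormD x y; apply: ae_mp h _.
by apply: ae_mp (realL0_addE (rnorm x) (rnorm y)) _; apply: aeW => w ->.
Qed.

Lemma rnormN x : rnorm (- x) = rnorm x.
Proof.
have -> : - x = embed k (0 - 1) *: x by rewrite embedB embed0 embed1 sub0r scaleN1r.
apply/realL0P; apply: ae_mp (rnorm_embed (0 - 1) x) _.
apply: ae_mp (realL0_subE 0 (1 : realL0 P)) _.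
apply: ae_mp (realL0_0E P) _; apply: ae_mp (realL0_1E P) _.
by apply: aeW => w -> -> -> ->; rewrite sub0r normrN normr1 mul1r.
Qed.

Lemma rnorm_triangleB x y : \forall w \ae P, rnorm (x - y) w <= rnorm x w + rnorm y w.
Proof. by rewrite -(rnormN y); exact: rnorm_triangle. Qed.

(** Used to evaluate the random norm of a sum on an event: wherever the random
norm of y vanishes, x + y and x have the same random norm. *)
Lemma rnorm_lipschitz x y :
  \forall w \ae P, `|rnorm (x + y) w - rnorm x w| <= rnorm y w.
Proof.
apply: ae_mp (rnorm_triangle x y) _; apply: ae_mp (rnorm_triangle (x + y) (- y)) _.
rewrite addrK rnormN; apply: aeW => w; rewrite ler_norml; lra.
Qed.

Lemma rnorm_half x : \forall w \ae P,
  rnorm (((2^-1 : scalar_field R k)%:A : L0 P k) *: x) w = 2^-1 * rnorm x w.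
Proof.
have -> : ((2^-1 : scalar_field R k)%:A : L0 P k) = embed k (2^-1)%:A.
  apply/L0P; apply: ae_mp (embedE k (2^-1)%:A) _.
  apply: ae_mp (realL0_constE P 2^-1) _.
  have h : \forall w \ae P, ((2^-1 : scalar_field R k)%:A : L0 P k) w = 2^-1.
    apply: filterS3 (L0_mulE (L0_const P (2^-1 : scalar_field R k)) 1)
      (L0_constE P (2^-1 : scalar_field R k))
      (L0_constE P (1 : scalar_field R k)) => w e1 e2 e3.
    by rewrite [LHS]e1 e2 [X in _ * X]e3 mulr1.
  apply: ae_mp h _; apply: aeW => w -> -> ->.
  by case: k => //=; rewrite fmorphV rmorph_nat.
apply: ae_mp (rnorm_embed (2^-1)%:A x) _; apply: ae_mp (realL0_constE P 2^-1) _.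
by apply: aeW => w -> ->; rewrite ger0_norm// invr_ge0.
Qed.

Definition midpoint x y : E := ((2^-1 : scalar_field R k)%:A : L0 P k) *: (x + y).

Lemma rnorm_midpoint_le x y :
  \forall w \ae P, rnorm (midpoint x y) w <= 2^-1 * (rnorm x w + rnorm y w).
Proof.
apply: ae_mp (rnorm_half (x + y)) _; apply: ae_mp (rnorm_triangle x y) _.
by apply: aeW => w h ->; rewrite ler_pM2l// invr_gt0.
Qed.

(** The reciprocal of 0 is 0, so the random norm of the normalization is the
indicator of the support of x. *)
Definition normalization x : E := embed k (recip (rnorm x)) *: x.

Lemma rnorm_normalization x :
  \forall w \ae P, rnorm (normalization x) w = (rnorm x w != 0)%:R.
Proof.
apply: ae_mp (rnorm_embed (recip (rnorm x)) x) _; apply: ae_mp (recipE (rnorm x)) _.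
apply: ae_mp (rnorm_pos x) _; apply: aeW => w x0 -> ->.
have [->|?] := eqVneq (rnorm x w) 0; first by rewrite mulr0.
by rewrite ger0_norm ?invr_ge0// mulVf.
Qed.

End rn_calculus.

(** * Unit vectors in a complete module of full support *)

Section exhaustion.
Context d (T : measurableType d) (R : realType) (P : probability T R).
Context (k : scalar_kind) (E : rnModType P k).
Implicit Types x y z : E.
Local Open Scope quotient_scope.

Definition indicator_norm x : Prop :=
  \forall w \ae P, rnorm x w = 0 \/ rnorm x w = 1.

(** Elements of E have no values at outcomes, so agreement with x on the support
of x is expressed by the vanishing of the random norm of the difference.  Along an
increasing sequence for this relation, a later term differs from an earlier one
only on the event that the support gains. *)
Definition extends x y : Prop :=
  \forall w \ae P, rnorm x w != 0 -> rnorm (y - x) w = 0.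

Lemma indicator_normalization x : indicator_norm (normalization x).
Proof.
apply: ae_mp (rnorm_normalization x) _; apply: aeW => w ->.
by case: eqVneq; [left|right].
Qed.

(** The vector equal to x on the support of x and to y elsewhere. *)
Definition glue x y : E :=
  x + embed k (realL0_indic P (measurableC (measurable_nonzero (rnorm x)))) *: y.

Lemma glue_correction x y : \forall w \ae P,
  rnorm (glue x y - x) w = if rnorm x w == 0 then rnorm y w else 0.
Proof.
rewrite /glue addrAC subrr add0r.
set mx := measurableC (measurable_nonzero (rnorm x)).
apply: ae_mp (rnorm_embed (realL0_indic P mx) y) _.
apply: ae_mp (realL0_indicE P mx) _; apply: aeW => w -> ->.
rewrite indicE in_setC mem_setE unfold_in /nonzero/= negbK.
by case: (rnorm x w == 0); rewrite ?normr1 ?normr0 ?mul1r ?mul0r.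
Qed.

Lemma extends_glue x y : extends x (glue x y).
Proof.
apply: ae_mp (glue_correction x y) _; apply: aeW => w ->.
by case: eqVneq.
Qed.

Lemma extends_refl x : extends x x.
Proof.
rewrite /extends subrr (_ : rnorm 0 = 0); last exact/rnorm_eq0.
by apply: ae_mp (realL0_0E P) _; exact: aeW.
Qed.

Lemma extends_rnorm x y : extends x y ->
  \forall w \ae P, rnorm x w != 0 -> rnorm y w = rnorm x w.
Proof.
move=> xy; apply: ae_mp xy _; apply: ae_mp (rnorm_lipschitz x (y - x)) _.
rewrite addrC subrK; apply: aeW => w h xy nz; apply/eqP.
by rewrite -subr_eq0 -normr_le0; apply: le_trans h _; rewrite xy.
Qed.

Lemma extends_trans y x z : extends x y -> extends y z -> extends x z.
Proof.
move=> xy yz; apply: ae_mp (extends_rnorm xy) _; apply: ae_mp xy _.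
apply: ae_mp yz _; apply: ae_mp (rnorm_triangle (z - y) (y - x)) _.
rewrite addrA subrK; apply: ae_mp (rnorm_pos (z - x)) _.
apply: aeW => w p0 h yz xy nxy nz; apply/eqP; rewrite eq_le p0 andbT.
by apply: le_trans h _; rewrite xy// yz ?addr0// nxy.
Qed.

Lemma rnorm_glue x y : \forall w \ae P,
  rnorm (glue x y) w = if rnorm x w == 0 then rnorm y w else rnorm x w.
Proof.
apply: ae_mp (extends_rnorm (extends_glue x y)) _.
apply: ae_mp (glue_correction x y) _.
apply: ae_mp (rnorm_lipschitz (glue x y - x) x) _; rewrite subrK.
apply: aeW => w + eq e; rewrite eq; case: eqVneq => [x0|/e//].
by rewrite x0 normr_le0 subr_eq0 => /eqP.
Qed.

Lemma indicator_norm_glue x y : indicator_norm x -> indicator_norm y ->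
  indicator_norm (glue x y).
Proof.
move=> Ux Uy; apply: ae_mp (rnorm_glue x y) _; apply: ae_mp Ux _.
by apply: ae_mp Uy _; apply: aeW => w Uy Ux ->; case: ifP.
Qed.

Definition support_prob x : R := fine (P (norm_support x)).

Lemma support_probE x : P (norm_support x) = (support_prob x)%:E.
Proof. by rewrite fineK// fin_num_measure//; exact: measurable_nonzero. Qed.

Lemma measurable_rnorm_ge (eps : R) x : measurable [set w | eps <= rnorm x w].
Proof.
rewrite (_ : [set _ | _] = [set w | 0 <= (rnorm x \- cst eps) w]).
  by apply: measurable_ge0; apply: measurable_funB => //; exact: measurable_realL0.
by apply/seteqP; split => w /=; rewrite subr_ge0.
Qed.

(** The difference y - x vanishes on the support of x and its own support lies
in that of y, so the event on the left is disjoint from the support of x and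
their union is contained in the support of y. *)
Lemma extends_support_prob (eps : R) x y : 0 < eps -> extends x y ->
  (P [set w | (eps <= rnorm (y - x) w)%R] <= (support_prob y - support_prob x)%:E)%E.
Proof.
move=> eps0 xy; rewrite EFinB -support_probE -support_probE leeBrDr; last first.
  by rewrite support_probE.
have mx := measurable_nonzero (rnorm x).
pose F := [set w | eps <= rnorm (y - x) w].
have mF : measurable F by exact: measurable_rnorm_ge.
have mFx := measurableD mF mx.
apply: (@le_trans _ _ (P (F `\` norm_support x) + P (norm_support x))%E).
  apply: leeD => //; apply: ae_measure_le => //; apply: ae_mp xy _.
  apply: aeW => w xy Fw; split => // /xy; move: Fw; rewrite /F/= => + e.
  by rewrite e leNgt eps0.
rewrite -measureU//; last by rewrite setDE -setIA setICl setI0.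
apply: ae_measure_le; [exact: measurableU|exact: measurable_nonzero|].
apply: ae_mp (extends_rnorm xy) _; apply: ae_mp (rnorm_lipschitz (y - x) x) _.
rewrite subrK; apply: aeW => w h e [[Fw /negP]|]; last first.
  by rewrite /norm_support/nonzero/= => nz; rewrite e.
rewrite /norm_support/nonzero/= negbK => /eqP x0.
move: h; rewrite x0 normr_le0 subr_eq0 => /eqP ->.
by rewrite gt_eqF// (lt_le_trans eps0).
Qed.

Lemma support_prob_le x y :
  (\forall w \ae P, rnorm x w != 0 -> rnorm y w != 0) ->
  support_prob x <= support_prob y.
Proof.
move=> h; rewrite -lee_fin -!support_probE.
by apply: ae_measure_le => //; exact: measurable_nonzero.
Qed.

(** On the support of z n all later terms agree with z n, so there the distance
from l to z n is at most the distance from l to z m for every later m, and the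
latter tends to 0 in probability. *)
Lemma extends_limit (z : E^nat) l :
  (forall n m, (n <= m)%N -> extends (z n) (z m)) -> cvg_in_probability z l ->
  forall n, extends (z n) l.
Proof.
move=> ext zl n.
suff h (j : nat) : \forall w \ae P,
    ~ (norm_support (z n) w /\ j.+1%:R^-1 <= rnorm (l - z n) w).
  have := ae_foralln h; apply: filterS2 (rnorm_pos (l - z n)) => w p0 hw nz.
  apply/eqP; rewrite eq_le p0 andbT leNgt; apply/negP => lt0.
  have [j jlt] := ltr_add_invr lt0.
  by apply: (hw j); split => //; rewrite add0r in jlt; exact: ltW.
pose A := norm_support (z n) `&` [set w | j.+1%:R^-1 <= rnorm (l - z n) w].
have mA : measurable A.
  by apply: measurableI; [exact: measurable_nonzero|exact: measurable_rnorm_ge].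
have j0 : 0 < j.+1%:R^-1 :> R by rewrite invr_gt0.
apply: (null_set_ae mA); apply/eqP; rewrite eq_le measure_ge0 andbT.
have zl0 := zl _ j0; rewrite -(cvg_lim _ zl0)//.
apply: lime_ge; first by apply/cvg_ex; exists 0%E.
near=> m; apply: ae_measure_le => //; first exact: measurable_rnorm_ge.
have nm : (n <= m)%N by near: m; exact: nbhs_infty_ge.
apply: ae_mp (ext n m nm) _; apply: ae_mp (rnorm_triangle (l - z m) (z m - z n)) _.
rewrite addrA subrK -(rnormN (l - z m)) opprB.
apply: aeW => w h e [nz far] /=; apply: le_trans far _.
by move: h; rewrite e// addr0.
Unshelve. all: by end_near. Qed.

(** By [extends_support_prob] the distance between two terms exceeds eps with a
probability at most the difference of the probabilities of their supports,
whatever eps is, and these probabilities converge to s. *)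
Lemma cauchy_of_support_prob (z : E^nat) (s : R) :
  (forall n m, (n <= m)%N -> extends (z n) (z m)) ->
  (forall n, support_prob (z n) <= s) ->
  (forall n, s - n.+1%:R^-1 <= support_prob (z n)) ->
  cauchy_in_probability z.
Proof.
move=> ext le_s ge_s eps eps0.
pose bound (p : nat * nat) : \bar R := (p.1.+1%:R^-1 + p.2.+1%:R^-1)%:E.
have boundC n m : bound (n, m) = bound (m, n) by rewrite /bound/= addrC.
have inv0 (n : nat) : 0 <= n.+1%:R^-1 :> R by rewrite invr_ge0.
apply: (@squeeze_cvge _ _ _ _ (cst 0%E) _ bound).
- apply: nearW => -[n m] /=; rewrite measure_ge0/=.
  wlog nm : n m / (n <= m)%N => [H|].
    have [|/ltnW] := leqP n m; first exact: H.
    by move=> /H; rewrite -(rnormN (z m - z n)) opprB boundC.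
  rewrite -rnormN opprB; apply: le_trans (extends_support_prob eps0 (ext _ _ nm)) _.
  rewrite -[leRHS]/((n.+1%:R^-1 + m.+1%:R^-1)%:E) lee_fin.
  have := le_s m; have := ge_s n; have := inv0 m.
  by move: (n.+1%:R^-1) (m.+1%:R^-1) => a b; lra.
- exact: cvg_cst.
- rewrite -[X in _ --> X]adde0.
  have hinv : (n.+1%:R^-1)%:E @[n --> \oo] --> (0 : \bar R)%E by exact: cvge_harmonic.
  apply: (@cvgeD _ _ _ _ (fun p : nat * nat => (p.1.+1%:R^-1)%:E)
    (fun p : nat * nat => (p.2.+1%:R^-1)%:E)) => //.
    by apply: cvg_comp hinv; exact: cvg_fst.
  by apply: cvg_comp hinv; exact: cvg_snd.
Qed.

(** Exhaustion: vectors whose support has nearly maximal probability are glued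
one after the other into an increasing sequence.  The sequence is Cauchy, and
its limit, by completeness, has a support of maximal probability.  A vector y
living partly outside that support could be glued to the limit and would
increase the probability further. *)
Lemma exists_maximal_support : rn_complete E ->
  exists2 l : E, indicator_norm l &
    forall y, \forall w \ae P, rnorm l w = 0 -> rnorm y w = 0.
Proof.
move=> complete; pose probs := [set support_prob x | x in indicator_norm].
have prob_le1 x : support_prob x <= 1.
  by rewrite -lee_fin -support_probE probability_le1//; exact: measurable_nonzero.
have has_sup_probs : has_sup probs.
  split; last by exists 1 => _ [x _ <-].
  exists (support_prob (normalization 0)), (normalization 0) => //.
  exact: indicator_normalization.
pose s := sup probs.
have le_s x : indicator_norm x -> support_prob x <= s.
  by move=> Ux; apply: sup_upper_bound => //; exists x.
have /choice[x xP] : forall n, exists x,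
    indicator_norm x /\ s - n.+1%:R^-1 <= support_prob x.
  move=> n; have n0 : 0 < n.+1%:R^-1 :> R by rewrite invr_gt0.
  by have [_ [x Ux <-] /ltW ?] := sup_adherent n0 has_sup_probs; exists x.
pose z := fix z (n : nat) : E := if n is m.+1 then glue (z m) (x n) else x 0%N.
have Uz n : indicator_norm (z n).
  elim: n => [|n IHn]; first by case: (xP 0%N).
  by apply: indicator_norm_glue => //; case: (xP n.+1).
have zS n : extends (z n) (z n.+1) by exact: extends_glue.
have ext n m : (n <= m)%N -> extends (z n) (z m).
  elim: m => [|m IHm]; first by rewrite leqn0 => /eqP ->; exact: extends_refl.
  rewrite leq_eqVlt => /predU1P[->|]; first exact: extends_refl.
  by rewrite ltnS => /IHm /extends_trans; apply.
have ge_s n : s - n.+1%:R^-1 <= support_prob (z n).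
  have [_ h] := xP n; apply: le_trans h _; case: n => [//|n].
  apply: support_prob_le; apply: ae_mp (rnorm_glue (z n) (x n.+1)) _.
  by apply: aeW => w -> nz; case: ifPn.
have [l zl] := complete z (cauchy_of_support_prob ext (fun n => le_s _ (Uz n)) ge_s).
have extl := extends_limit ext zl.
pose l1 := normalization l.
have suppl : \forall w \ae P, rnorm l1 w = (rnorm l w != 0)%:R.
  exact: rnorm_normalization.
exists l1; first exact: indicator_normalization.
move=> y; pose y1 := glue l1 (normalization y).
have ml : s <= support_prob l1.
  rewrite leNgt; apply/negP; rewrite -subr_gt0 => /ltr_add_invr[n].
  rewrite add0r ltNge => /negP; apply.
  have : support_prob (z n) <= support_prob l1.
    apply: support_prob_le; apply: ae_mp (extends_rnorm (extl n)) _.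
    apply: ae_mp suppl _; apply: aeW => w -> h nz.
    by rewrite h// nz oner_neq0.
  by have := ge_s n; move: n.+1%:R^-1 => a; lra.
have y1l : support_prob y1 <= support_prob l1.
  apply: le_trans (le_s _ _) ml.
  apply: indicator_norm_glue; exact: indicator_normalization.
pose D := norm_support y1 `\` norm_support l1.
have mD : measurable D by apply: measurableD; exact: measurable_nonzero.
have gl := rnorm_glue l1 (normalization y).
suff PD : P D = 0%E.
  apply: ae_mp (null_set_ae mD PD) _; apply: ae_mp gl _.
  apply: ae_mp (rnorm_normalization y) _; apply: aeW => w -> + nD l0.
  rewrite l0 eqxx => e; apply/eqP; apply: contrapT => /negP nz; apply: nD.
  by rewrite /D/norm_support/nonzero/=; split; rewrite ?e ?nz ?oner_neq0 ?l0 ?eqxx.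
have : (P D + P (norm_support l1) <= P (norm_support y1))%E.
  have disj : D `&` norm_support l1 = set0.
    by rewrite /D setDE -setIA setICl setI0.
  rewrite -measureU//; last exact: measurable_nonzero.
  apply: ae_measure_le.
  - by apply: measurableU => //; exact: measurable_nonzero.
  - exact: measurable_nonzero.
  apply: ae_mp gl _; apply: aeW => w e [[]//|].
  by rewrite /norm_support/nonzero/= e => nz; rewrite (negbTE nz).
rewrite !support_probE -leeBrDr// -EFinB => PD.
apply/eqP; rewrite eq_le measure_ge0 andbT; apply: le_trans PD _.
by rewrite lee_fin subr_le0.
Qed.

(** Outside a maximal support every random norm vanishes, hence so does their
essential supremum; full support then makes that complement a null set. *)
Lemma exists_unit_norm : rn_complete E -> full_support E ->
  exists x0 : E, \forall w \ae P, rnorm x0 w = 1.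
Proof.
move=> /exists_maximal_support[l Ul lmax] [zeta [zeta_ub zeta_least] zeta0].
(* The extended random variable b bounds every random norm almost surely. *)
pose b w : \bar R := if rnorm l w == 0 then 0%E else +oo%E.
have mb : measurable_fun setT b.
  apply: measurable_fun_ifT => //; apply: (@measurable_fun_bool _ _ _ _ false).
  rewrite setTI (_ : _ @^-1` _ = nonzero (rnorm l)); first exact: measurable_nonzero.
  by apply/seteqP; split => w; rewrite /nonzero /=; case: eqVneq.
pose bm : {mfun T >-> \bar R} := HB.pack_for {mfun T >-> \bar R} b
  (isMeasurableFun.Build _ _ _ _ b mb).
pose zeta' : {mfun_ P, T >-> \bar R} := \pi_{mfun_ P, T >-> \bar R} bm.
have zeta'E : \forall w \ae P, zeta' w = b w.
  have /eqmodP/asboolP : bm = repr zeta'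
    %[mod {mfun_ P, T >-> \bar R}] by rewrite reprK.
  by apply: filterS => w /(_ Logic.I) /= ->.
have zeta_ge0 : \forall w \ae P, (0 <= zeta w)%E.
  have h : [set rnorm x | x in [set: E]] 0 by exists 0 => //; exact/rnorm_eq0.
  by apply: ae_mp (zeta_ub _ h) _; apply: ae_mp (realL0_0E P) _; apply: aeW => w ->.
exists l; have h : \forall w \ae P, (zeta w <= zeta' w)%E.
  apply: zeta_least => _ [y _ <-]; apply: ae_mp zeta'E _.
  apply: ae_mp (lmax y) _; apply: aeW => w h ->; rewrite /b.
  by case: eqVneq => [/h ->//|_]; rewrite leey.
apply: ae_mp h _; apply: ae_mp zeta'E _; apply: ae_mp zeta_ge0 _.
apply: ae_mp zeta0 _; apply: ae_mp Ul _; apply: aeW => w [l0|//] nz ge0 ->.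
by rewrite /b l0 eqxx => le0; case/eqP: nz; apply/eqP; rewrite eq_le le0.
Qed.

End exhaustion.

(** * Pointwise form of random uniform convexity *)

Section random_unit_sphere_facts.
Context d (T : measurableType d) (R : realType) (P : probability T R).
Context (k : scalar_kind) (E : rnModType P k).
Implicit Types (x y : E).

(** The unit sphere condition says that the random norm is the indicator of
its own support. *)
Lemma random_unit_sphereP x : random_unit_sphere x <->
  x <> 0 /\ \forall w \ae P, rnorm x w = 0 \/ rnorm x w = 1.
Proof.
have indE : \forall w \ae P,
    rnorm (L0_indic P k (measurable_nonzero (rnorm x)) *: x) w =
    \1_(nonzero (rnorm x)) w * rnorm x w.
  exact: rnorm_indic.
have h := realL0_indicE P (measurable_nonzero (rnorm x)).
split=> [[x0 /realL0P e]|[x0 e]]; split => //; last apply/realL0P.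
  apply: ae_mp indE _; apply: ae_mp h _; apply: ae_mp e _.
  apply: aeW => w -> -> /esym; rewrite indicE mem_setE unfold_in /nonzero/=.
  have [->|x_neq0] := eqVneq (rnorm x w) 0; first by left.
  by rewrite mul1r; right.
apply: ae_mp indE _; apply: ae_mp h _; apply: ae_mp e _.
apply: aeW => w e -> ->; rewrite indicE mem_setE unfold_in /nonzero/=.
by case: e => ->; rewrite ?eqxx ?mulr0 // oner_eq0 mulr1.
Qed.

Lemma L_sharp_const (a : R) : 0 < a -> L_sharp (a%:A : realL0 P).
Proof.
move=> a0; split; last by exists a.
apply/realL0_leP; apply: ae_mp (realL0_0E P) _; apply: ae_mp (realL0_constE P a) _.
by apply: aeW => w -> ->; exact: ltW.
Qed.

(** A modulus of random uniform convexity only has to be known for constant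
eps, and it can be taken constant: a member of [L_sharp] is bounded below by a
positive real.  Two vectors of equal random norm f are brought to the sphere by
the common factor 1 / f, and undoing this factor multiplies the inequality of
the definition by f. *)
Lemma random_uniformly_convex_pointwise : random_uniformly_convex E ->
  forall eps : R, 0 < eps <= 2 -> exists2 delta : R, 0 < delta <= 1 &
  forall x y, rnorm x = rnorm y -> \forall w \ae P,
    eps * rnorm x w <= rnorm (x - y) w ->
    rnorm (midpoint x y) w <= (1 - delta) * rnorm x w.
Proof.
move=> ruc eps /andP[eps0 eps2].
have le2 : (eps%:A : realL0 P) <= 2%:R.
  apply/realL0_leP; apply: ae_mp (realL0_constE P eps) _.
  have := realL0_addE (1 : realL0 P) 1; apply: filterS2 (realL0_1E P) => w e1 e2 ->.
  by rewrite [leRHS]e2 e1.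
have [delta [[_ [lam lam0 /realL0_leP lamle]] _ H]] :=
  ruc _ (L_sharp_const eps0) le2.
exists (Num.min lam 1); first by rewrite lt_min lam0 ltr01 ge_min lexx orbT.
set dl := Num.min lam 1; move=> x y xy.
have f0 := rnorm_pos x.
pose D := nonzero (rnorm x) `&` [set w | 0 <= (rnorm (x - y) \- eps \*o rnorm x) w].
have mD : measurable D.
  apply: measurableI; first exact: measurable_nonzero.
  apply: measurable_ge0; apply: measurable_funB; first exact: measurable_realL0.
  by apply: measurable_funM => //; exact: measurable_realL0.
(* The definition only speaks of non-null events. *)
have [PD0|PDn0] := eqVneq (P D) 0%E.
  apply: ae_mp (null_set_ae mD PD0) _; apply: ae_mp (rnorm_midpoint_le x y) _.
  apply: ae_mp f0 _; apply: aeW => w f0 + nD le; rewrite -xy => h.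
  have [e|ne] := eqVneq (rnorm x w) 0; first by move: h; rewrite e addr0 !mulr0.
  by exfalso; apply: nD; split => //=; rewrite subr_ge0.
have PD : (0 < P D)%E by rewrite lt0e PDn0 measure_ge0.
pose g := recip (rnorm x).
have normg (z : E) : rnorm z = rnorm x -> \forall w \ae P,
    rnorm (embed k g *: z) w = (rnorm x w != 0)%:R.
  by move=> zx; rewrite /g -zx; exact: rnorm_normalization.
have sph (z : E) : rnorm z = rnorm x -> random_unit_sphere (embed k g *: z).
  move=> zx; apply/random_unit_sphereP; split; last first.
    apply: ae_mp (normg z zx) _; apply: aeW => w ->.
    by case: eqVneq => _; [left|right].
  move=> z0; move: PDn0; apply/negP; rewrite negbK.
  apply/eqP/(negligibleP P mD).
  have := normg z zx; rewrite z0 (_ : rnorm 0 = 0); last exact/rnorm_eq0.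
  move=> h; have : \forall w \ae P, ~ D w; last first.
    by apply: negligibleS => w /= Dw /(_ Dw).
  apply: ae_mp h _; apply: ae_mp (realL0_0E P) _; apply: aeW => w -> e [/=].
  by move=> nz; move: e; rewrite nz => /eqP; rewrite eq_sym oner_eq0.
have normB : \forall w \ae P, rnorm (embed k g *: x - embed k g *: y) w =
    (rnorm x w)^-1 * rnorm (x - y) w.
  rewrite -scalerBr; apply: ae_mp (rnorm_embed g (x - y)) _.
  apply: ae_mp (recipE (rnorm x)) _; apply: ae_mp f0 _.
  by apply: aeW => w f0 -> ->; rewrite ger0_norm ?invr_ge0.
have normM : \forall w \ae P, rnorm (midpoint (embed k g *: x) (embed k g *: y)) w =
    (rnorm x w)^-1 * rnorm (midpoint x y) w.
  rewrite /midpoint -scalerDr scalerA mulrC -scalerA.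
  apply: ae_mp (rnorm_embed g (midpoint x y)) _.
  apply: ae_mp (recipE (rnorm x)) _; apply: ae_mp f0 _.
  by apply: aeW => w f0 -> ->; rewrite ger0_norm ?invr_ge0.
have nx := normg x erefl; have ny := normg y (esym xy).
have indD := realL0_indicE P mD.
have supp : \forall w \ae P, D w -> (norm_support (embed k g *: x) `&`
    norm_support (embed k g *: y) `&`
    norm_support (embed k g *: x - embed k g *: y)) w.
  rewrite /norm_support /nonzero; apply: ae_mp normB _; apply: ae_mp nx _.
  apply: ae_mp ny _; apply: ae_mp f0 _; apply: aeW => w f0 ey ex eB [/= nz].
  rewrite subr_ge0 ey ex eB nz oner_neq0 => h; split => //.
  have f_gt0 : 0 < rnorm x w by rewrite lt0r nz.
  by rewrite gt_eqF// mulr_gt0 ?invr_gt0// (lt_le_trans _ h)// mulr_gt0.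
have far : eps%:A * realL0_indic P mD <=
    realL0_indic P mD * rnorm (embed k g *: x - embed k g *: y).
  apply/realL0_leP; apply: ae_mp (realL0_mulE eps%:A (realL0_indic P mD)) _.
  apply: ae_mp (realL0_mulE (realL0_indic P mD)
    (rnorm (embed k g *: x - embed k g *: y))) _.
  apply: ae_mp normB _; apply: ae_mp indD _; apply: ae_mp f0 _.
  apply: ae_mp (realL0_constE P eps) _.
  apply: aeW => w -> f0 -> -> -> ->; rewrite indicE.
  case: (boolP (w \in D)); rewrite ?mulr0 ?mul0r// => /set_mem[/= nz].
  rewrite subr_ge0 mulr1 mul1r => h; have f_gt0 : 0 < rnorm x w by rewrite lt0r nz.
  by rewrite ler_pdivlMl// mulrC.
have /realL0_leP := H _ _ (sph x erefl) (sph y (esym xy)) D mD supp PD far.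
rewrite -[_ *: _]/(midpoint (embed k g *: x) (embed k g *: y)) => concl.
apply: ae_mp concl _; apply: ae_mp (realL0_mulE (realL0_indic P mD)
    (rnorm (midpoint (embed k g *: x) (embed k g *: y)))) _.
apply: ae_mp (realL0_mulE (1 - delta) (realL0_indic P mD)) _.
apply: ae_mp (realL0_subE 1 delta) _; apply: ae_mp (realL0_1E P) _.
apply: ae_mp normM _; apply: ae_mp indD _; apply: ae_mp f0 _.
apply: ae_mp lamle _; apply: ae_mp (realL0_constE P lam) _.
apply: ae_mp (rnorm_midpoint_le x y) _; apply: aeW => w mid_le -> lamle f0.
move=> -> -> -> -> -> ->.
rewrite indicE -xy in mid_le * => + far_w.
have [e|nz] := eqVneq (rnorm x w) 0.
  by move: mid_le; rewrite e addr0 !mulr0.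
rewrite mem_set; last by split => //=; rewrite subr_ge0.
have f_gt0 : 0 < rnorm x w by rewrite lt0r nz.
rewrite mul1r mulr1 ler_pdivrMl// mulrC => /le_trans; apply.
rewrite ler_pM2r// lerB//; apply: le_trans lamle.
by rewrite /dl ge_min lexx.
Qed.

End random_unit_sphere_facts.

(** * Transfer of uniform convexity for a function norm *)

(** Where the norm is finite the definition can be read in the real numbers. *)
Lemma uniformly_convexP (R : realType) (K : numFieldType) (V : lmodType K)
    (X : set V) (nrm : V -> \bar R) :
  (forall x, X x -> nrm x \is a fin_num) ->
  (forall x y, X x -> X y -> X (x - y)) ->
  (forall x y, X x -> X y -> X (2^-1 *: (x + y))) ->
  uniformly_convex X nrm <->
  forall eps : R, 0 < eps <= 2 -> exists2 delta : R, 0 < delta &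
    forall x y : V, X x -> X y -> fine (nrm x) = 1 -> fine (nrm y) = 1 ->
      eps <= fine (nrm (x - y)) -> fine (nrm (2^-1 *: (x + y))) <= 1 - delta.
Proof.
move=> fin XB Xm.
have fin1 x : X x -> nrm x = 1%E <-> fine (nrm x) = 1.
  by move=> Xx; split=> [->//|n1]; rewrite -[nrm x]fineK ?fin// n1.
have finle x c : X x -> (nrm x <= c%:E)%E = (fine (nrm x) <= c).
  by move=> Xx; rewrite -lee_fin fineK ?fin.
have finge x c : X x -> (c%:E <= nrm x)%E = (c <= fine (nrm x)).
  by move=> Xx; rewrite -lee_fin fineK ?fin.
split=> uc eps /uc[delta d0 H]; exists delta => // x y Xx Xy nx ny h.
  by rewrite -finle; [apply: H; rewrite ?fin1 ?finge//; exact: XB|exact: Xm].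
by rewrite finle; [apply: H; rewrite -?fin1 -?finge//; exact: XB|exact: Xm].
Qed.

Section function_norms.
Context d (T : measurableType d) (R : realType) (P : probability T R).

(** The properties of the Orlicz space and of its two norms on which the
equivalence rests.  The monotonicity [fnorm_le] and the solidity [fnorm_solid]
make the space and the norm depend on the modulus of a random variable only,
which lets them be transported to a module through the random norm; the positive
norms of indicators are used to localize on an event. *)
Record function_norm (X : set (realL0 P)) (N : realL0 P -> \bar R) : Prop := {
  fnorm_ge0 : forall xi, (0 <= N xi)%E;
  fnorm_le : forall xi eta : realL0 P,
    (\forall w \ae P, `|xi w| <= `|eta w|) -> (N xi <= N eta)%E;
  fnormD : forall xi eta : realL0 P, (N (xi + eta)%R <= N xi + N eta)%E;
  fnormZ : forall (a : R) (xi : realL0 P), 0 < a -> (N (a *: xi)%R <= a%:E * N xi)%E;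
  fnorm_fin : forall xi, X xi -> (N xi < +oo)%E;
  fnorm_solid : forall xi eta : realL0 P,
    (\forall w \ae P, `|xi w| <= `|eta w|) -> X eta -> X xi;
  fnorm_spaceD : forall xi eta : realL0 P, X xi -> X eta -> X (xi + eta);
  fnorm_spaceZ : forall (a : R) (xi : realL0 P), 0 < a -> X xi -> X (a *: xi);
  fnorm_indic : forall (D : set T) (mD : measurable D), (0 < P D)%E ->
    X (realL0_indic P mD) /\ (0 < N (realL0_indic P mD))%E }.

Variables (X : set (realL0 P)) (N : realL0 P -> \bar R).
Hypothesis fnN : function_norm X N.
Let n xi := fine (N xi).

Lemma fnorm_fin_num (xi : realL0 P) : X xi -> N xi \is a fin_num.
Proof. by move=> Xx; rewrite ge0_fin_numE ?(fnorm_fin fnN)// (fnorm_ge0 fnN). Qed.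

Lemma fine_fnormZ (a : R) (xi : realL0 P) : 0 < a -> X xi -> n (a *: xi) = a * n xi.
Proof.
move=> a0 Xx.
have le b (eta : realL0 P) : 0 < b -> X eta -> n (b *: eta) <= b * n eta.
  move=> b0 Xe; rewrite -lee_fin EFinM !fineK ?fnorm_fin_num//.
    exact: (fnormZ fnN).
  exact: (fnorm_spaceZ fnN).
apply/eqP; rewrite eq_le le//= -ler_pdivlMl//.
rewrite -[in leLHS](scale1r xi) -(mulVf (lt0r_neq0 a0)) -scalerA.
by apply: le; rewrite ?invr_gt0//; exact: (fnorm_spaceZ fnN).
Qed.

(** This combines monotonicity, the triangle inequality and homogeneity in the
form in which they are applied: an almost sure inequality between moduli passes
to the norms. *)
Lemma fnorm_domination2 (a b : R) (xi eta zeta : realL0 P) : 0 < a -> 0 < b ->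
  X eta -> X zeta -> (\forall w \ae P, `|xi w| <= a * `|eta w| + b * `|zeta w|) ->
  X xi /\ n xi <= a * n eta + b * n zeta.
Proof.
move=> a0 b0 Xe Xz le.
pose abs_rv (th : realL0 P) : realL0 P := realL0_class P (measurable_abs th).
have absE (th : realL0 P) : \forall w \ae P, abs_rv th w = `|th w|.
  exact: realL0_classE.
have Xabs (th : realL0 P) : X th -> X (abs_rv th) /\ n (abs_rv th) <= n th.
  move=> Xt; have h : \forall w \ae P, `|abs_rv th w| <= `|th w|.
    by apply: ae_mp (absE th) _; apply: aeW => w ->; rewrite normr_id.
  have Xa : X (abs_rv th) by exact: (fnorm_solid fnN) h Xt.
  by split => //; apply: fine_le; rewrite ?fnorm_fin_num// (fnorm_le fnN).
have [Xe' ne'] := Xabs _ Xe; have [Xz' nz'] := Xabs _ Xz.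
have Xs : X (a *: abs_rv eta + b *: abs_rv zeta).
  by apply: (fnorm_spaceD fnN); exact: (fnorm_spaceZ fnN).
have h : \forall w \ae P,
    `|xi w| <= `|(a *: abs_rv eta + b *: abs_rv zeta : realL0 P) w|.
  apply: ae_mp (realL0_addE (a *: abs_rv eta : realL0 P)
    (b *: abs_rv zeta : realL0 P)) _.
  apply: ae_mp (realL0_scaleE a (abs_rv eta)) _.
  apply: ae_mp (realL0_scaleE b (abs_rv zeta)) _.
  apply: ae_mp (absE eta) _; apply: ae_mp (absE zeta) _; apply: ae_mp le _.
  apply: aeW => w le -> -> -> -> ->; rewrite [leRHS]ger0_norm//.
  by rewrite addr_ge0// mulr_ge0// ltW.
have Xx : X xi by exact: (fnorm_solid fnN) h Xs.
split => //.
apply: (@le_trans _ _ (n (a *: abs_rv eta + b *: abs_rv zeta))).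
  by apply: fine_le; rewrite ?fnorm_fin_num// (fnorm_le fnN).
apply: (@le_trans _ _ (n (a *: abs_rv eta) + n (b *: abs_rv zeta))).
  rewrite -lee_fin EFinD !fineK ?fnorm_fin_num//; last 2 first.
    exact: (fnorm_spaceZ fnN).
    exact: (fnorm_spaceZ fnN).
  exact: (fnormD fnN).
rewrite !fine_fnormZ//; apply: lerD; rewrite ler_pM2l//.
Qed.

Lemma fnorm_domination (a : R) (xi eta : realL0 P) : 0 < a ->
  X eta -> (\forall w \ae P, `|xi w| <= a * `|eta w|) ->
  X xi /\ n xi <= a * n eta.
Proof.
move=> a0 Xe h; have a20 : 0 < a / 2 by lra.
have := @fnorm_domination2 (a / 2) (a / 2) xi eta eta a20 a20 Xe Xe.
rewrite (_ : a * n eta = a / 2 * n eta + a / 2 * n eta); last by lra.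
by apply; apply: ae_mp h _; apply: aeW => w; lra.
Qed.

Lemma fnorm_eq (xi eta : realL0 P) :
  (\forall w \ae P, `|xi w| = `|eta w|) -> N xi = N eta.
Proof.
move=> h; apply/eqP; rewrite eq_le !(fnorm_le fnN)//.
  by apply: ae_mp h _; apply: aeW => w ->.
by apply: ae_mp h _; apply: aeW => w ->.
Qed.

Lemma fnorm_spaceB (xi eta : realL0 P) : X xi -> X eta -> X (xi - eta).
Proof.
move=> Xx Xe.
refine (proj1 (fnorm_domination2 ltr01 ltr01 Xx Xe _)).
apply: ae_mp (realL0_subE xi eta) _; apply: aeW => w ->.
by rewrite !mul1r ler_normB.
Qed.

Lemma fnorm_uniformly_convexP : @uniformly_convex R R (realL0 P) X N <->
  forall eps : R, 0 < eps <= 2 -> exists2 delta : R, 0 < delta &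
    forall xi eta : realL0 P, X xi -> X eta -> n xi = 1 -> n eta = 1 ->
      eps <= n (xi - eta) -> n (2^-1 *: (xi + eta)) <= 1 - delta.
Proof.
apply: uniformly_convexP; first exact: fnorm_fin_num.
  exact: fnorm_spaceB.
move=> xi eta Xx Xe; apply: (fnorm_spaceZ fnN); first by rewrite invr_gt0.
exact: (fnorm_spaceD fnN).
Qed.

Context (k : scalar_kind) (E : rnModType P k).
Implicit Types x y : E.

Definition module_space : set (restrict_scalars E) :=
  [set x | X (rnorm (x : E))].

Lemma fnorm_rnormB x y : X (rnorm x) -> X (rnorm y) ->
  X (rnorm (x - y)) /\ n (rnorm (x - y)) <= n (rnorm x) + n (rnorm y).
Proof.
move=> Xx Xy; rewrite -[n (rnorm x)]mul1r -[n (rnorm y)]mul1r.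
apply: fnorm_domination2 => //.
apply: ae_mp (rnorm_triangleB x y) _; apply: ae_mp (rnorm_pos x) _.
apply: ae_mp (rnorm_pos y) _; apply: ae_mp (rnorm_pos (x - y)) _.
by apply: aeW => w xy0 y0 x0; rewrite !ger0_norm// !mul1r.
Qed.

Lemma fnorm_midpoint x y : X (rnorm x) -> X (rnorm y) -> X (rnorm (midpoint x y)).
Proof.
move=> Xx Xy.
have h0 : 0 < 2^-1 :> R by rewrite invr_gt0.
refine (proj1 (fnorm_domination2 h0 h0 Xx Xy _)).
apply: ae_mp (rnorm_midpoint_le x y) _; apply: ae_mp (rnorm_pos x) _.
apply: ae_mp (rnorm_pos y) _; apply: ae_mp (rnorm_pos (midpoint x y)) _.
by apply: aeW => w xy0 y0 x0; rewrite !ger0_norm// mulrDr.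
Qed.

Lemma module_uniformly_convexP :
  @uniformly_convex R (scalar_field R k) (restrict_scalars E)
    module_space (induced_norm E N) <->
  forall eps : R, 0 < eps <= 2 -> exists2 delta : R, 0 < delta &
    forall x y, X (rnorm x) -> X (rnorm y) -> n (rnorm x) = 1 ->
      n (rnorm y) = 1 -> eps <= n (rnorm (x - y)) ->
      n (rnorm (midpoint x y)) <= 1 - delta.
Proof.
apply: uniformly_convexP => [x|x y|x y]; first exact: fnorm_fin_num.
  by move=> Xx Xy; have [] := fnorm_rnormB Xx Xy.
exact: fnorm_midpoint.
Qed.

(** The map xi |-> xi x0 embeds the function space isometrically. *)
Lemma uniformly_convex_space_of_module (x0 : E) :
  (\forall w \ae P, rnorm x0 w = 1) ->
  @uniformly_convex R (scalar_field R k) (restrict_scalars E)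
    module_space (induced_norm E N) ->
  @uniformly_convex R R (realL0 P) X N.
Proof.
move=> x01 /module_uniformly_convexP uc; apply/fnorm_uniformly_convexP => eps.
move=> /uc[delta d0 H]; exists delta => // xi eta Xxi Xeta nxi neta far.
have embnorm (zeta : realL0 P) :
    \forall w \ae P, `|rnorm (embed k zeta *: x0) w| = `|zeta w|.
  apply: ae_mp (rnorm_embed zeta x0) _; apply: ae_mp x01 _.
  by apply: aeW => w -> ->; rewrite mulr1 normr_id.
have Xemb (zeta : realL0 P) : X zeta -> X (rnorm (embed k zeta *: x0)).
  apply: (fnorm_solid fnN); apply: ae_mp (embnorm zeta) _.
  by apply: aeW => w ->.
have nemb (zeta : realL0 P) : n (rnorm (embed k zeta *: x0)) = n zeta.
  by rewrite /n (fnorm_eq (embnorm zeta)).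
have -> : n (2^-1 *: (xi + eta)) =
    n (rnorm (midpoint (embed k xi *: x0) (embed k eta *: x0))).
  rewrite /n; congr fine; apply: fnorm_eq.
  rewrite /midpoint -scalerDl -embedD.
  apply: ae_mp (rnorm_half (embed k (xi + eta) *: x0)) _.
  apply: ae_mp (embnorm (xi + eta)) _; apply: ae_mp (realL0_scaleE 2^-1 (xi + eta)) _.
  by apply: aeW => w -> e ->; rewrite !normrM e.
apply: H; rewrite ?nemb//; [exact: Xemb|exact: Xemb|].
by rewrite -scalerBl -embedB nemb.
Qed.

(** Suppose that the inequality for the midpoint fails on a non-null part D' of
D.  Multiplying x and y by 1_D' / N (1_D') gives two unit vectors of the module
whose distance is at least lam, the lower bound of eps, and whose midpoint has
norm at least 1 - dl.  Uniform convexity bounds this norm by 1 - delta, and dl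
was chosen smaller than delta. *)
Lemma random_uniformly_convex_of_module :
  @uniformly_convex R (scalar_field R k) (restrict_scalars E)
    module_space (induced_norm E N) ->
  random_uniformly_convex E.
Proof.
move=> /module_uniformly_convexP uc eps.
move=> [_ [lam lam0 /realL0_leP lam_eps]] /realL0_leP eps2.
have lamE := realL0_constE P lam.
have lam2 : lam <= 2.
  have [|w] := @probability_ae_exists _ _ _ P (fun w => lam <= 2); last by [].
  apply: ae_mp lam_eps _; apply: ae_mp lamE _; apply: ae_mp eps2 _.
  apply: ae_mp (realL0_addE (1 : realL0 P) 1) _; apply: ae_mp (realL0_1E P) _.
  by apply: aeW => w e1 e2; rewrite [X in _ <= X]e2 e1 => h -> /le_trans; exact.
have [|delta delta0 H] := uc lam; first by rewrite lam0.
(* The bound 1/2 keeps 1 - dl positive, so that it can be divided by. *)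
pose dl := Num.min (delta / 2) 2^-1.
have dl0 : 0 < dl by rewrite lt_min divr_gt0//= invr_gt0.
have dl_half : dl <= 2^-1 by rewrite ge_min lexx orbT.
have dl_delta : dl <= delta / 2 by rewrite ge_min lexx.
have dlE := realL0_constE P dl.
exists dl%:A; split; first exact: L_sharp_const.
  apply/realL0_leP; apply: ae_mp dlE _; apply: ae_mp (realL0_1E P) _.
  by apply: aeW => w -> ->; lra.
move=> x y /random_unit_sphereP[_ Sx] /random_unit_sphereP[_ Sy].
move=> D mD DB PD /realL0_leP far.
rewrite -[_ *: _]/(midpoint x y); have mp := rnorm_pos (midpoint x y).
pose D' := D `&` ~` [set w | 0 <= (cst (1 - dl) \- rnorm (midpoint x y)) w].
have mD' : measurable D'.
  apply: measurableI => //; apply: measurableC; apply: measurable_ge0.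
  by apply: measurable_funB => //; exact: measurable_realL0.
have [PD'0|PD'n0] := eqVneq (P D') 0%E.
  apply/realL0_leP.
  apply: ae_mp (realL0_mulE (realL0_indic P mD) (rnorm (midpoint x y))) _.
  apply: ae_mp (realL0_mulE (1 - dl%:A) (realL0_indic P mD)) _.
  apply: ae_mp (realL0_subE 1 (dl%:A : realL0 P)) _; apply: ae_mp (realL0_1E P) _.
  apply: ae_mp dlE _; apply: ae_mp (realL0_indicE P mD) _.
  apply: ae_mp (null_set_ae mD' PD'0) _; apply: aeW => w nD' -> -> -> -> -> ->.
  rewrite indicE; case: (boolP (w \in D)) => [/set_mem Dw|_]; last first.
    by rewrite mul0r mulr0.
  rewrite mul1r mulr1; apply: contrapT => h; apply: nD'; split => //=.
  by rewrite subr_ge0.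
have PD' : (0 < P D')%E by rewrite lt0e PD'n0 measure_ge0.
have [XD' ND'] := fnorm_indic fnN mD' PD'.
pose c := n (realL0_indic P mD').
have c0 : 0 < c by rewrite -lte_fin fineK// fnorm_fin_num.
have c'0 : 0 < c^-1 by rewrite invr_gt0.
pose g : realL0 P := c^-1 *: realL0_indic P mD'.
have gE : \forall w \ae P, g w = c^-1 * \1_D' w.
  apply: ae_mp (realL0_scaleE c^-1 (realL0_indic P mD')) _.
  by apply: ae_mp (realL0_indicE P mD') _; apply: aeW => w -> ->.
have g0 : \forall w \ae P, 0 <= g w.
  by apply: ae_mp gE _; apply: aeW => w ->; rewrite indicE mulr_ge0// ltW.
have Xg : X g by exact: (fnorm_spaceZ fnN).
have ng : n g = 1 by rewrite fine_fnormZ// mulVf// gt_eqF.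
have normg z : \forall w \ae P, rnorm (embed k g *: z : E) w = g w * rnorm z w.
  apply: ae_mp (rnorm_embed g z) _; apply: ae_mp g0 _.
  by apply: aeW => w g0 ->; rewrite ger0_norm.
(* An outcome where g does not vanish lies in D'. *)
have onD (Q : T -> Prop) :
    (\forall w \ae P, D w -> 1 - dl < rnorm (midpoint x y) w -> Q w) ->
    \forall w \ae P, g w != 0 -> Q w.
  move=> h; apply: ae_mp h _; apply: ae_mp gE _; apply: aeW => w -> h.
  rewrite indicE; case: (boolP (w \in D')); last by rewrite mulr0 eqxx.
  move=> /set_mem[Dw /negP]; rewrite -ltNge subr_lt0 => midw _.
  exact: h.
have unit_norm z : (\forall w \ae P, rnorm z w = 0 \/ rnorm z w = 1) ->
    (\forall w \ae P, D w -> norm_support z w) ->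
    X (rnorm (embed k g *: z : E)) /\ n (rnorm (embed k g *: z)) = 1.
  move=> z01 Dz; have h : \forall w \ae P, `|rnorm (embed k g *: z) w| = `|g w|.
    have : \forall w \ae P, g w != 0 -> rnorm z w = 1.
      apply: onD; apply: ae_mp z01 _; apply: ae_mp Dz _; apply: aeW => w.
      by move=> h [z0|//] /h; rewrite /norm_support/nonzero/= z0 eqxx.
    move=> z1; apply: ae_mp z1 _; apply: ae_mp (normg z) _; apply: aeW => w ->.
    by have [->|_ ->//] := eqVneq (g w) 0; rewrite ?mul0r ?mulr1.
  split; last by rewrite /n (fnorm_eq h).
  by apply: (fnorm_solid fnN) Xg; apply: ae_mp h _; apply: aeW => w ->.
have [Xx' nx'] : X (rnorm (embed k g *: x)) /\ n (rnorm (embed k g *: x)) = 1.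
  by apply: unit_norm Sx _; apply: ae_mp DB _; apply: aeW => w h /h[[]].
have [Xy' ny'] : X (rnorm (embed k g *: y)) /\ n (rnorm (embed k g *: y)) = 1.
  by apply: unit_norm Sy _; apply: ae_mp DB _; apply: aeW => w h /h[[]].
have lower b z : 0 < b -> X (rnorm (embed k g *: z : E)) ->
    (\forall w \ae P, D w -> 1 - dl < rnorm (midpoint x y) w -> b <= rnorm z w) ->
    b <= n (rnorm (embed k g *: z)).
  move=> b0 Xz /onD bz; have b'0 : 0 < b^-1 by rewrite invr_gt0.
  have [|_] := @fnorm_domination b^-1 g (rnorm (embed k g *: z)) b'0 Xz.
    apply: ae_mp (normg z) _; apply: ae_mp bz _; apply: ae_mp g0 _.
    apply: aeW => w g0; have [->|nz] := eqVneq (g w) 0.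
      by move=> _ ->; rewrite mul0r !normr0 mulr0.
    move=> /(_ isT) bz ->; rewrite normrM mulrCA ler_peMr// ler_pdivlMl// mulr1.
    exact: le_trans bz (ler_norm _).
  by rewrite ng ler_pdivlMl// mulr1.
have := H _ _ Xx' Xy' nx' ny'.
rewrite /midpoint -scalerBr -scalerDr scalerA mulrC -scalerA.
rewrite -/(midpoint x y) => /(_ _)/le_gtF.
have hb : 0 < 1 - dl by lra.
have hfar : lam <= n (rnorm (embed k g *: (x - y))).
  apply: lower => //; first by rewrite scalerBr; have [] := fnorm_rnormB Xx' Xy'.
  apply: ae_mp far _; apply: ae_mp lam_eps _; apply: ae_mp lamE _.
  apply: ae_mp (realL0_mulE eps (realL0_indic P mD)) _.
  apply: ae_mp (realL0_mulE (realL0_indic P mD) (rnorm (x - y))) _.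
  apply: ae_mp (realL0_indicE P mD) _; apply: aeW => w -> -> -> ->.
  move=> le + Dw _; rewrite indicE mem_set// mulr1 mul1r; exact: le_trans.
have hmid : 1 - dl <= n (rnorm (embed k g *: midpoint x y)).
  apply: lower => //; last by apply: aeW => w _ /ltW.
  have := fnorm_midpoint Xx' Xy'.
  by rewrite {1}/midpoint -scalerDr scalerA mulrC -scalerA.
move=> /(_ hfar)/negbT; rewrite -leNgt => h.
exfalso; lra.
Qed.

(** Let f be the common random norm.  On the event D where the random norm of
x - y is at least (eps / 2) f, random uniform convexity makes the random norm of
the midpoint at most (1 - d1) f, while off D nothing is gained.  To see that a
gain on D alone lowers the norm N, reflect f on D: g = f - 2 (1_D f) has the
same modulus as f, hence the same norm, and it is far from f, because N (2 1_D f)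
is at least N (|x - y|) - eps / 2.  Uniform convexity of the function space then
keeps the norm of the midpoint of f and g, which is f restricted to the
complement of D, away from 1. *)
Lemma equal_norm_uniform_convexity :
  @uniformly_convex R R (realL0 P) X N -> random_uniformly_convex E ->
  forall eps : R, 0 < eps <= 2 -> exists2 delta : R, 0 < delta &
    forall x y, rnorm x = rnorm y -> X (rnorm x) -> n (rnorm x) = 1 ->
      eps <= n (rnorm (x - y)) -> n (rnorm (midpoint x y)) <= 1 - delta.
Proof.
move=> /fnorm_uniformly_convexP uc /random_uniformly_convex_pointwise ruc eps eps02.
have e02 : 0 < eps / 2 <= 2 by lra.
have [d1 d1_01 Hruc] := ruc _ e02; have [eta eta0 Huc] := uc _ e02.
(* Halving d1 keeps the weight 1 - d1 / 2 of f positive. *)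
exists (d1 / 2 * eta); first by rewrite mulr_gt0//; lra.
move=> x y xy Xx nx far; have ruc_xy := Hruc x y xy.
pose f := rnorm x; have f0 : \forall w \ae P, 0 <= f w by exact: rnorm_pos.
pose D := [set w | 0 <= (rnorm (x - y) \- eps / 2 \*o f) w].
have mD : measurable D.
  apply: measurable_ge0; apply: measurable_funB; first exact: measurable_realL0.
  by apply: measurable_funM => //; exact: measurable_realL0.
pose u : realL0 P := realL0_indic P mD * f.
have uE : \forall w \ae P, u w = \1_D w * f w.
  apply: ae_mp (realL0_mulE (realL0_indic P mD) f) _.
  by apply: ae_mp (realL0_indicE P mD) _; apply: aeW => w -> ->.
have Xu : X u.
  apply: (fnorm_solid fnN) Xx; apply: ae_mp uE _; apply: aeW => w ->.
  by rewrite indicE; case: (_ \in _); rewrite ?mul1r ?mul0r ?normr0.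
have two0 : 0 < 2 :> R by [].
have e0 : 0 < eps / 2 by lra.
(* |x - y| <= (eps / 2) f + 2 (1_D f). *)
have nu : eps / 2 <= 2 * n u.
  have [|_] := @fnorm_domination2 (eps / 2) 2 (rnorm (x - y)) f u e0 two0 Xx Xu.
    apply: ae_mp (rnorm_triangleB x y) _; apply: ae_mp (rnorm_pos (x - y)) _.
    apply: ae_mp uE _; apply: ae_mp f0 _; rewrite -xy -/f.
    apply: aeW => w f0 -> xy0 xyle; rewrite (ger0_norm f0) (ger0_norm xy0) indicE.
    case: (boolP (w \in D)) => wD.
      rewrite mul1r (ger0_norm f0); apply: le_trans xyle _.
      by have := mulr_ge0 (ltW e0) f0; lra.
    rewrite mul0r normr0 mulr0 addr0 ltW//; rewrite -subr_lt0 ltNge.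
    by apply: contra wD => h; rewrite mem_set.
  by rewrite -/f in nx *; rewrite nx; lra.
pose g : realL0 P := f - 2 *: u.
have gE : \forall w \ae P, g w = f w - 2 * (\1_D w * f w).
  apply: ae_mp (realL0_subE f (2 *: u)) _; apply: ae_mp (realL0_scaleE 2 u) _.
  by apply: ae_mp uE _; apply: aeW => w -> -> ->.
have absg : \forall w \ae P, `|g w| = `|f w|.
  apply: ae_mp gE _; apply: aeW => w ->; rewrite indicE.
  case: (_ \in _); rewrite ?mul0r ?mulr0 ?subr0// mul1r -normrN; congr `| _ |; lra.
have Xg : X g.
  by apply: (fnorm_solid fnN) Xx; apply: ae_mp absg _; apply: aeW => w ->.
pose h : realL0 P := 2^-1 *: (f + g).
have hE : \forall w \ae P, h w = (1 - \1_D w) * f w.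
  apply: ae_mp (realL0_scaleE 2^-1 (f + g)) _.
  apply: ae_mp (realL0_addE f g) _; apply: ae_mp gE _.
  by apply: aeW => w -> -> ->; lra.
have Xh : X h.
  by apply: (fnorm_spaceZ fnN); [rewrite invr_gt0|exact: (fnorm_spaceD fnN)].
have nh : n h <= 1 - eta.
  apply: Huc => //; first by rewrite /n (fnorm_eq absg).
  by rewrite /g opprB addrC subrK fine_fnormZ.
have a0 : 0 < 1 - d1 / 2 by lra.
have b0 : 0 < d1 / 2 by lra.
(* (1 - d1 / 2) f + (d1 / 2) h equals (1 - d1 / 2) f on D and f off D. *)
have [|_ nmid] := @fnorm_domination2 _ _ (rnorm (midpoint x y)) f h a0 b0 Xx Xh.
  apply: ae_mp ruc_xy _; apply: ae_mp (rnorm_midpoint_le x y) _.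
  apply: ae_mp (rnorm_pos (midpoint x y)) _; apply: ae_mp f0 _.
  apply: ae_mp hE _; rewrite -xy -/f; apply: aeW => w -> f0 m0 mle mD_le.
  rewrite (ger0_norm f0) (ger0_norm m0) indicE; case: (boolP (w \in D)) => wD.
    rewrite subrr mul0r normr0 mulr0 addr0; apply: le_trans (mD_le _) _.
      by rewrite -subr_ge0; exact: (set_mem wD).
    by rewrite ler_wpM2r//; lra.
  by rewrite subr0 mul1r (ger0_norm f0); lra.
apply: le_trans nmid _; rewrite -/f in nx *; rewrite nx.
have := ler_wpM2l (ltW b0) nh; lra.
Qed.

(** Take y' = (|x| / |y|) y where y does not vanish and y' = x elsewhere. *)
Lemma exists_same_norm x y : exists2 y' : E, rnorm y' = rnorm x &
  \forall w \ae P, rnorm (y' - y) w <= `|rnorm x w - rnorm y w|.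
Proof.
have mg0 := measurableC (measurable_nonzero (rnorm y)).
pose q : realL0 P := rnorm x * recip (rnorm y).
have qE : \forall w \ae P, q w = rnorm x w / rnorm y w.
  apply: ae_mp (realL0_mulE (rnorm x) (recip (rnorm y))) _.
  by apply: ae_mp (recipE (rnorm y)) _; apply: aeW => w -> ->.
pose u1 : E := embed k q *: y; pose u2 : E := embed k (realL0_indic P mg0) *: x.
have u1E : \forall w \ae P, rnorm u1 w = `|q w| * rnorm y w by exact: rnorm_embed.
have u2E : \forall w \ae P, rnorm u2 w = (rnorm y w == 0)%:R * rnorm x w.
  apply: ae_mp (rnorm_embed (realL0_indic P mg0) x) _.
  apply: ae_mp (realL0_indicE P mg0) _; apply: aeW => w -> ->.
  rewrite indicE in_setC mem_setE unfold_in /nonzero/= negbK.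
  by case: (rnorm y w == 0); rewrite ?normr1 ?normr0.
have fx := rnorm_pos x; have fy := rnorm_pos y.
exists (u1 + u2).
  apply/realL0P; apply: ae_mp (rnorm_lipschitz u1 u2) _.
  apply: ae_mp (rnorm_lipschitz u2 u1) _; rewrite (addrC u2).
  apply: ae_mp u1E _; apply: ae_mp u2E _; apply: ae_mp qE _.
  apply: ae_mp fx _; apply: ae_mp fy _; apply: aeW => w y0 x0 -> -> ->.
  have [->|ny0] := eqVneq (rnorm y w) 0.
    by rewrite mulr0 mul1r normr_le0 subr_eq0 => /eqP.
  rewrite mul0r (ger0_norm (divr_ge0 x0 y0)) divfK// => _.
  by rewrite normr_le0 subr_eq0 => /eqP.
have -> : u1 + u2 - y = embed k (q - 1) *: y + u2.
  by rewrite embedB embed1 scalerBl scale1r addrAC.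
apply: ae_mp (rnorm_triangle (embed k (q - 1) *: y) u2) _.
apply: ae_mp (rnorm_embed (q - 1) y) _; apply: ae_mp (realL0_subE q 1) _.
apply: ae_mp u2E _; apply: ae_mp qE _; apply: ae_mp (realL0_1E P) _.
apply: ae_mp fx _; apply: ae_mp fy _; apply: aeW => w y0 x0 -> -> -> -> ->.
move=> /le_trans; apply; have [->|ny0] := eqVneq (rnorm y w) 0.
  by rewrite mulr0 mul1r add0r subr0 ger0_norm.
by rewrite mul0r addr0 -{2}(ger0_norm y0) -normrM mulrBl divfK// mul1r.
Qed.

(** Two unit vectors that are far apart either have random norms that are far
apart in the function space, and its uniform convexity suffices, or y can be
replaced by a close vector with the random norm of x, and
[equal_norm_uniform_convexity] applies.  The threshold e1 between the two cases
is so small that the replacement costs less than it gains. *)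
Lemma uniformly_convex_module :
  @uniformly_convex R R (realL0 P) X N -> random_uniformly_convex E ->
  @uniformly_convex R (scalar_field R k) (restrict_scalars E)
    module_space (induced_norm E N).
Proof.
move=> uc ruc; apply/module_uniformly_convexP => eps eps02.
have e02 : 0 < eps / 2 <= 2 by lra.
have [d0 d0_gt0 Hsame] := equal_norm_uniform_convexity uc ruc e02.
pose e1 := Num.min (eps / 2) d0.
have e1_eps : e1 <= eps / 2 by rewrite ge_min lexx.
have e1_d0 : e1 <= d0 by rewrite ge_min lexx orbT.
have e1_gt0 : 0 < e1 by rewrite lt_min d0_gt0 andbT; lra.
have e102 : 0 < e1 <= 2 by lra.
have [eta eta0 Huc] := (fnorm_uniformly_convexP.1 uc) _ e102.
exists (Num.min eta (d0 / 2)); first by rewrite lt_min eta0 divr_gt0.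
have min_eta : Num.min eta (d0 / 2) <= eta by rewrite ge_min lexx.
have min_d0 : Num.min eta (d0 / 2) <= d0 / 2 by rewrite ge_min lexx orbT.
move=> x y Xx Xy nx ny far.
have half0 : 0 < 2^-1 :> R by rewrite invr_gt0.
have Xf := fnorm_spaceB Xx Xy.
have [far_norms|close_norms] := leP e1 (n (rnorm x - rnorm y)).
  have Xs : X (2^-1 *: (rnorm x + rnorm y)).
    by apply: (fnorm_spaceZ fnN) => //; exact: (fnorm_spaceD fnN).
  have [|_ h] := @fnorm_domination 1 (rnorm (midpoint x y)) _ ltr01 Xs.
    apply: ae_mp (realL0_scaleE 2^-1 (rnorm x + rnorm y)) _.
    apply: ae_mp (realL0_addE (rnorm x) (rnorm y)) _.
    apply: ae_mp (rnorm_midpoint_le x y) _; apply: ae_mp (rnorm_pos (midpoint x y)) _.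
    apply: aeW => w m0 h -> ->; rewrite mul1r ger0_norm//.
    exact: le_trans h (ler_norm _).
  apply: le_trans h _; rewrite mul1r.
  apply: le_trans (Huc _ _ Xx Xy nx ny far_norms) _; lra.
have [y' y'x y'y] := exists_same_norm x y.
have Xy' : X (rnorm y') by rewrite y'x.
have [Xxy' _] := fnorm_rnormB Xx Xy'; have [Xy'y _] := fnorm_rnormB Xy' Xy.
have nclose : n (rnorm (y' - y)) <= n (rnorm x - rnorm y).
  rewrite -[leRHS]mul1r; refine (proj2 (fnorm_domination ltr01 Xf _)).
  apply: ae_mp y'y _; apply: ae_mp (rnorm_pos (y' - y)) _.
  apply: ae_mp (realL0_subE (rnorm x) (rnorm y)) _.
  by apply: aeW => w -> d0' h; rewrite mul1r ger0_norm.
have far' : eps <= n (rnorm (x - y')) + n (rnorm (y' - y)).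
  apply: le_trans far _; rewrite -[X in _ <= X + _]mul1r -[X in _ <= _ + X]mul1r.
  refine (proj2 (fnorm_domination2 ltr01 ltr01 Xxy' Xy'y _)).
  apply: ae_mp (rnorm_triangle (x - y') (y' - y)) _; rewrite addrA subrK.
  apply: ae_mp (rnorm_pos (y' - y)) _; apply: ae_mp (rnorm_pos (x - y')) _.
  apply: ae_mp (rnorm_pos (x - y)) _; apply: aeW => w p1 p2 p3.
  by rewrite !mul1r !ger0_norm.
have near_mid : n (rnorm (midpoint x y)) <=
    1 * n (rnorm (midpoint x y')) + 2^-1 * n (rnorm (y' - y)).
  refine (proj2 (fnorm_domination2 ltr01 half0 (fnorm_midpoint Xx Xy') Xy'y _)).
  apply: ae_mp (rnorm_triangleB (x + y') (y' - y)) _.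
  rewrite opprB addrACA subrr addr0.
  apply: ae_mp (rnorm_half (x + y)) _; apply: ae_mp (rnorm_half (x + y')) _.
  apply: ae_mp (rnorm_pos (midpoint x y)) _; apply: ae_mp (rnorm_pos (midpoint x y')) _.
  apply: ae_mp (rnorm_pos (y' - y)) _; rewrite -/(midpoint x y) -/(midpoint x y').
  by apply: aeW => w p1 p2 p3 e1' e2'; rewrite !ger0_norm// e1' e2'; lra.
have := Hsame x y' (esym y'x) Xx nx; lra.
Qed.

End function_norms.

(** * Young functions and the Luxemburg norm *)

Section gauges.
Context d (T : measurableType d) (R : realType) (P : probability T R).
Variable F : R -> \bar R.
Hypothesis F_nd : forall s t : R, 0 <= s -> s <= t -> (F s <= F t)%E.
Hypothesis F_ge0 : forall t : R, 0 <= t -> (0 <= F t)%E.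
Implicit Types xi eta : realL0 P.

(** Only the values on the nonnegative half-line are controlled, so F is
precomposed with the positive part, after which upper level sets are intervals. *)
Lemma measurable_gauge (f : T -> R) : measurable_fun setT f ->
  (forall w, 0 <= f w) -> measurable_fun setT (F \o f).
Proof.
move=> mf f0; rewrite (_ : F \o f = (fun t => F (Num.max t 0)) \o f); last first.
  by apply/funext => w /=; rewrite max_l.
apply: measurableT_comp => // => _.
apply: (measurability _ (ErealGenCInfty.measurableE R)) => //.
move=> _ [_ [x ->] <-]; rewrite setTI; apply: is_interval_measurable.
move=> a b /=; rewrite !in_itv/= !andbT => xa xb c /andP[ac cb].
rewrite in_itv/= andbT; apply: le_trans xa _; apply: F_nd.
  by rewrite le_max lexx orbT.
by rewrite ge_max le_max ac/= le_max lexx orbT.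
Qed.

Lemma measurable_gauge_abs (a : R) xi : 0 <= a ->
  measurable_fun setT (fun w => F (a * `|xi w|)).
Proof.
move=> a0; apply: (@measurable_gauge (fun w => a * `|xi w|)) => [|w].
  by apply: measurable_funM => //; exact: measurable_abs.
by rewrite mulr_ge0.
Qed.

Lemma gauge_integral_le (a b : R) xi eta : 0 <= a -> 0 <= b ->
  (\forall w \ae P, a * `|xi w| <= b * `|eta w|) ->
  (\int[P]_w F (a * `|xi w|)%R <= \int[P]_w F (b * `|eta w|)%R)%E.
Proof.
move=> a0 b0 h; apply: ae_ge0_le_integral => //.
- by move=> w _; rewrite F_ge0// mulr_ge0.
- exact: measurable_gauge_abs.
- by move=> w _; rewrite F_ge0// mulr_ge0.
- exact: measurable_gauge_abs.
- by apply: ae_mp h _; apply: aeW => w le _; rewrite F_nd// mulr_ge0.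
Qed.

Lemma orlicz_space_solid xi eta : (\forall w \ae P, `|xi w| <= `|eta w|) ->
  orlicz_space P F eta -> orlicz_space P F xi.
Proof.
move=> h [c c0 fin]; exists c => //; apply: le_lt_trans fin.
apply: gauge_integral_le; rewrite ?ltW//.
by apply: ae_mp h _; apply: aeW => w le; rewrite ler_pM2l.
Qed.

(** A scaling on the left gives the integrands here the same shape as in the
definition of the Orlicz space. *)
Lemma luxemburgE xi : luxemburg_norm P F xi = ereal_inf [set lam%:E | lam in
  [set lam | 0 < lam /\ (\int[P]_w F (lam^-1 * `|xi w|)%R <= 1)%E]].
Proof.
rewrite /luxemburg_norm; congr (ereal_inf [set _ | _ in [set lam | _ /\ (_ <= _)%E]]).
by apply/funext => lam; congr integral; apply/funext => w; rewrite mulrC.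
Qed.

Lemma luxemburg_le xi eta : (\forall w \ae P, `|xi w| <= `|eta w|) ->
  (luxemburg_norm P F xi <= luxemburg_norm P F eta)%E.
Proof.
move=> h; rewrite !luxemburgE; apply: ereal_inf_le_tmp => _ [lam [lam0 le1] <-].
exists lam => //; split => //; apply: le_trans le1.
apply: gauge_integral_le; rewrite ?invr_ge0 ?ltW//.
by apply: ae_mp h _; apply: aeW => w le; rewrite ler_pM2l ?invr_gt0.
Qed.

Lemma luxemburg_le_of_integral xi lam : 0 < lam ->
  (\int[P]_w F (lam^-1 * `|xi w|)%R <= 1)%E -> (luxemburg_norm P F xi <= lam%:E)%E.
Proof. by move=> lam0 le1; rewrite luxemburgE; apply: ereal_inf_lbound; exists lam. Qed.

Lemma luxemburg_lt xi lam : (luxemburg_norm P F xi < lam)%E -> exists2 mu : R,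
  0 < mu /\ (mu%:E < lam)%E & (\int[P]_w F (mu^-1 * `|xi w|)%R <= 1)%E.
Proof.
by rewrite luxemburgE => /ereal_inf_lt[_ [mu [mu0 le1] <-] lt]; exists mu.
Qed.

Lemma luxemburg_ge0 xi : (0 <= luxemburg_norm P F xi)%E.
Proof.
by apply: le_ereal_inf_tmp => _ [lam [lam0 _] <-]; rewrite lee_fin ltW.
Qed.

Lemma luxemburgZ (a : R) xi : 0 < a ->
  (luxemburg_norm P F (a *: xi)%R <= a%:E * luxemburg_norm P F xi)%E.
Proof.
move=> a0; rewrite -lee_pdivrMl// [leRHS]luxemburgE.
apply: le_ereal_inf_tmp => _ [lam [lam0 le1] <-].
rewrite lee_pdivrMl// -EFinM; apply: luxemburg_le_of_integral; first exact: mulr_gt0.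
apply: le_trans le1; apply: gauge_integral_le; rewrite ?invr_ge0 ?mulr_ge0 ?ltW//.
apply: ae_mp (realL0_scaleE a xi) _; apply: aeW => w ->.
by rewrite normrM (gtr0_norm a0) invfM [a^-1 * _]mulrC -mulrA mulKf ?gt_eqF.
Qed.

End gauges.

Section young_functions.
Context (R : realType) (Phi : R -> \bar R).
Hypothesis young : young_function Phi.

(** Convexity between t and 0, where Phi vanishes. *)
Lemma young_contract (a t : R) : 0 <= a <= 1 -> 0 <= t ->
  (Phi (a * t)%R <= a%:E * Phi t)%E.
Proof.
move=> a01 t0; have := young_convex young t0 (lexx 0) a01.
by rewrite mulr0 addr0 (young0 young) mule0 adde0.
Qed.

Lemma young_nd (s t : R) : 0 <= s -> s <= t -> (Phi s <= Phi t)%E.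
Proof.
move=> s0 st; have [t0|t0] := eqVneq t 0.
  by rewrite t0 (_ : s = 0)//; apply: le_anti; rewrite -{1}t0 st.
have tp : 0 < t by rewrite lt0r t0 (le_trans s0).
have st01 : 0 <= s / t <= 1.
  by rewrite divr_ge0 ?(ltW tp)//= ler_pdivrMr// mul1r.
have := young_contract st01 (ltW tp); rewrite divfK// => /le_trans; apply.
rewrite -[leRHS]mul1e; apply: lee_wpmul2r; first exact: (young_ge0 young) (ltW tp).
by rewrite lee_fin; case/andP: st01.
Qed.

Lemma young_large (M : R) : exists2 t : R, 0 < t & (M%:E < Phi t)%E.
Proof.
have /cvgeyPgt/(_ M) h := young_cvgy young.
have [|t [t0 Mt]] := @filter_ex _ (+oo : set_system R) _
  (fun t => 0 < t /\ (M%:E < Phi t)%E).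
  by apply: filterI h; exact: nbhs_pinfty_gt.
by exists t.
Qed.

Hypothesis Phi_fin : forall t : R, 0 <= t -> Phi t \is a fin_num.
Let Psi := young_conjugate Phi.

Lemma conjugate_nd (s t : R) : s <= t -> (Psi s <= Psi t)%E.
Proof.
move=> st; apply: ge_ereal_sup => _ [r r0 <-].
apply: (@le_trans _ _ ((r * t)%:E - Phi r)%E).
  by apply: leeB => //; rewrite lee_fin ler_wpM2l.
by apply: ereal_sup_ubound; exists r.
Qed.

Lemma conjugate_ge0 (s : R) : (0 <= Psi s)%E.
Proof.
apply: ereal_sup_ubound; exists 0; first exact: lexx.
by rewrite mul0r (young0 young) sube0.
Qed.

Lemma young_inequality (s t : R) : 0 <= s -> ((s * t)%:E <= Phi s + Psi t)%E.
Proof.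
move=> s0; rewrite addeC -leeBlDr ?Phi_fin//.
by apply: ereal_sup_ubound; exists s.
Qed.

(** A Young function grows at least linearly: if Phi t0 exceeds 1 then
Phi t >= t / t0 - 1 for all t >= 0, so that t / t0 - Phi t never exceeds 1. *)
Lemma conjugate_small : exists2 a : R, 0 < a & (Psi a <= 1)%E.
Proof.
have [t0 t0_gt0 Phi1] := young_large 1.
exists t0^-1; first by rewrite invr_gt0.
apply: ge_ereal_sup => _ [t t_ge0 <-].
rewrite leeBlDr ?Phi_fin//; have [tle|tgt] := leP t t0.
  apply: (@le_trans _ _ (1 + 0)%E); last by rewrite leeD2l// (young_ge0 young).
  by rewrite adde0 lee_fin ler_pdivrMr// mul1r.
have tp : 0 < t by exact: lt_trans t0_gt0 tgt.
have a01 : 0 <= t0 / t <= 1.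
  by rewrite divr_ge0 ?(ltW tp) ?(ltW t0_gt0)//= ler_pdivrMr// mul1r ltW.
have := young_contract a01 (ltW tp); rewrite divfK ?gt_eqF// => h.
have {h} := lt_le_trans Phi1 h; rewrite -(fineK (Phi_fin t_ge0)) -EFinM lte_fin => h.
rewrite -EFinD lee_fin.
have : t / t0 <= fine (Phi t).
  by rewrite ler_pdivrMr// mulrC; move: h; rewrite mulrAC ltr_pdivlMr// mul1r => /ltW.
lra.
Qed.

End young_functions.

Section luxemburg.
Context d (T : measurableType d) (R : realType) (P : probability T R).
Context (Phi : R -> \bar R) (young : young_function Phi).
Hypothesis Phi_fin : forall t : R, 0 <= t -> Phi t \is a fin_num.
Implicit Types xi eta : realL0 P.
Let nd := young_nd young.
Let ge0 := young_ge0 young.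

(** If the integral of Phi (c |xi|) is a finite m, convexity divides it by
1 + m at least when c is divided by 1 + m. *)
Lemma orlicz_space_luxemburg xi :
  orlicz_space P Phi xi <-> (luxemburg_norm P Phi xi < +oo)%E.
Proof.
split=> [[c c0 fin]|/luxemburg_lt[mu [mu0 _] le1]]; last first.
  by exists mu^-1; rewrite ?invr_gt0//; apply: le_lt_trans le1 _; rewrite ltry.
have I0 : (0 <= \int[P]_w Phi (c * `|xi w|)%R)%E.
  by apply: integral_ge0 => w _; apply: ge0; rewrite mulr_ge0// ltW.
have [m m0 Im] : exists2 m : R, 0 <= m & (\int[P]_w Phi (c * `|xi w|)%R = m%:E)%E.
  exists (fine (\int[P]_w Phi (c * `|xi w|)%R)); first exact: fine_ge0.
  by rewrite fineK// ge0_fin_numE.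
pose th := (1 + m)^-1; have th0 : 0 < th by rewrite invr_gt0; lra.
have th1 : th <= 1 by rewrite invf_le1; lra.
apply: (@le_lt_trans _ _ ((th * c)^-1)%:E); last by rewrite ltry.
apply: luxemburg_le_of_integral; first by rewrite invr_gt0 mulr_gt0.
rewrite invrK; apply: (@le_trans _ _ (\int[P]_w (th%:E * Phi (c * `|xi w|)%R))%E).
  apply: ge0_le_integral => //.
  - by move=> w _; apply: ge0; rewrite !mulr_ge0 ?(ltW th0) ?(ltW c0).
  - by apply: measurable_gauge_abs => //; rewrite mulr_ge0 ?(ltW th0) ?(ltW c0).
  - apply: emeasurable_funM; first exact: measurable_cst.
    by apply: measurable_gauge_abs => //; exact: ltW.
  - move=> w _; rewrite -mulrA; apply: young_contract => //.
      by rewrite (ltW th0).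
    by rewrite mulr_ge0 ?(ltW c0).
rewrite ge0_integralZl//; last 3 first.
- by apply: measurable_gauge_abs => //; exact: ltW.
- by move=> w _; apply: ge0; rewrite mulr_ge0 ?(ltW c0).
- by rewrite lee_fin ltW.
rewrite Im -EFinM lee_fin /th mulrC ler_pdivrMr; lra.
Qed.

(** The ratio |xi + eta| / (lam + mu) is at most the convex combination of
|xi| / lam and |eta| / mu with weights lam / (lam + mu) and mu / (lam + mu). *)
Lemma luxemburg_integralD xi eta (lam mu : R) : 0 < lam -> 0 < mu ->
  (\int[P]_w Phi (lam^-1 * `|xi w|)%R <= 1)%E ->
  (\int[P]_w Phi (mu^-1 * `|eta w|)%R <= 1)%E ->
  (luxemburg_norm P Phi (xi + eta)%R <= (lam + mu)%:E)%E.
Proof.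
move=> lam0 mu0 xi1 eta1; have s0 : 0 < lam + mu by exact: addr_gt0.
apply: luxemburg_le_of_integral => //.
pose th := lam / (lam + mu).
have th0 : 0 <= th by rewrite divr_ge0 ?(ltW lam0) ?(ltW s0).
have th1 : th <= 1 by rewrite ler_pdivrMr// mul1r lerDl ltW.
have th'E : 1 - th = mu / (lam + mu) by rewrite /th; field; rewrite gt_eqF.
have il0 : 0 <= lam^-1 by rewrite invr_ge0 ltW.
have im0 : 0 <= mu^-1 by rewrite invr_ge0 ltW.
have is0 : 0 <= (lam + mu)^-1 by rewrite invr_ge0 ltW.
have m1 : measurable_fun setT (fun w => th%:E * Phi (lam^-1 * `|xi w|)%R)%E.
  by apply: emeasurable_funM; [exact: measurable_cst|exact: measurable_gauge_abs].
have m2 : measurable_fun setT (fun w => (1 - th)%:E * Phi (mu^-1 * `|eta w|)%R)%E.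
  by apply: emeasurable_funM; [exact: measurable_cst|exact: measurable_gauge_abs].
have p1 w : (0 <= Phi (lam^-1 * `|xi w|)%R)%E by apply: ge0; exact: mulr_ge0.
have p2 w : (0 <= Phi (mu^-1 * `|eta w|)%R)%E by apply: ge0; exact: mulr_ge0.
apply: (@le_trans _ _ (\int[P]_w (th%:E * Phi (lam^-1 * `|xi w|)%R +
    (1 - th)%:E * Phi (mu^-1 * `|eta w|)%R))%E).
  apply: ae_ge0_le_integral => //.
  - by move=> w _; apply: ge0; rewrite mulr_ge0.
  - exact: measurable_gauge_abs.
  - by move=> w _; rewrite adde_ge0// mule_ge0// lee_fin// subr_ge0.
  - exact: emeasurable_funD.
  apply: ae_mp (realL0_addE xi eta) _; apply: aeW => w -> _.
  apply: (@le_trans _ _ (Phi (th * (lam^-1 * `|xi w|) +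
    (1 - th) * (mu^-1 * `|eta w|)))).
    apply: nd; first exact: mulr_ge0.
    rewrite th'E /th [leRHS](_ : _ = (lam + mu)^-1 * (`|xi w| + `|eta w|)).
      by rewrite ler_wpM2l// ler_normD.
    by field; rewrite !gt_eqF.
  by apply: (young_convex young); [exact: mulr_ge0|exact: mulr_ge0|exact/andP].
rewrite ge0_integralD//; last 2 first.
- by move=> w _; rewrite mule_ge0.
- by move=> w _; rewrite mule_ge0// lee_fin subr_ge0.
rewrite !ge0_integralZl//; last 3 first.
- exact: measurable_gauge_abs.
- by rewrite lee_fin subr_ge0.
- exact: measurable_gauge_abs.
rewrite [leRHS](_ : _ = (th%:E * 1 + (1 - th)%:E * 1)%E); last first.
  by rewrite !mule1 -EFinD addrC subrK.
by apply: leeD; apply: lee_wpmul2l => //; rewrite lee_fin// subr_ge0.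
Qed.

Lemma luxemburgD xi eta :
  (luxemburg_norm P Phi (xi + eta)%R <=
   luxemburg_norm P Phi xi + luxemburg_norm P Phi eta)%E.
Proof.
have xi0 := luxemburg_ge0 Phi xi; have eta0 := luxemburg_ge0 Phi eta.
have [->|xifin] := eqVneq (luxemburg_norm P Phi xi) +oo%E.
  by rewrite addye ?leey// gt_eqF// (lt_le_trans _ eta0) ?ltNyr.
have {}xifin : luxemburg_norm P Phi xi \is a fin_num.
  by rewrite ge0_fin_numE// lt_neqAle xifin leey.
rewrite addeC -leeBlDr// [leRHS]luxemburgE.
apply: le_ereal_inf_tmp => _ [mu [mu0 mu1] <-].
rewrite leeBlDr// addeC -leeBlDr// [leRHS]luxemburgE.
apply: le_ereal_inf_tmp => _ [lam [lam0 lam1] <-].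
by rewrite leeBlDr// -EFinD; exact: luxemburg_integralD.
Qed.

(** An indicator belongs to the space because Phi is finite.  It has a positive
norm because Phi is unbounded: for Phi t > 1 / P D, scaling the indicator by
more than t gives an integral above 1. *)
Lemma luxemburg_function_norm :
  function_norm (orlicz_space P Phi) (luxemburg_norm P Phi).
Proof.
split.
- by move=> xi; exact: luxemburg_ge0.
- exact: luxemburg_le.
- exact: luxemburgD.
- by move=> a xi; exact: luxemburgZ.
- by move=> xi /orlicz_space_luxemburg.
- exact: orlicz_space_solid.
- move=> xi eta /orlicz_space_luxemburg xifin /orlicz_space_luxemburg etafin.
  apply/orlicz_space_luxemburg; apply: le_lt_trans (luxemburgD _ _) _.
  exact: lte_add_pinfty.
- move=> a xi a0 /orlicz_space_luxemburg xifin; apply/orlicz_space_luxemburg.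
  apply: le_lt_trans (luxemburgZ nd ge0 _ a0) _.
  by rewrite lte_mul_pinfty// lee_fin ltW.
move=> D mD PD; have indE := realL0_indicE P mD; split.
  exists 1 => //; apply: (@le_lt_trans _ _ (Phi 1)); last first.
    by rewrite ltey_eq Phi_fin.
  rewrite -[leRHS]mule1 -(@probability_setT _ _ _ P) -integral_cst//.
  apply: ae_ge0_le_integral => //.
  - by move=> w _; apply: ge0; rewrite mulr_ge0.
  - exact: measurable_gauge_abs.
  - by move=> w _; exact: ge0.
  apply: ae_mp indE _; apply: aeW => w -> _; apply: nd; first by rewrite mulr_ge0.
  by rewrite mul1r indicE; case: (_ \in _); rewrite ?normr1 ?normr0.
have PDfin : P D \is a fin_num by exact: fin_num_measure.
have pd0 : 0 < fine (P D) by rewrite -lte_fin fineK.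
have [t t0 Mt] := young_large young (fine (P D))^-1.
apply: (@lt_le_trans _ _ (t^-1)%:E); first by rewrite lte_fin invr_gt0.
rewrite leNgt; apply/negP => /luxemburg_lt[lam [lam0]].
rewrite lte_fin => lamt; apply/negP; rewrite -ltNge.
have tlam : t <= lam^-1.
  by rewrite -[t]invrK ler_pV2 ?inE ?unitfE ?gt_eqF ?invr_gt0 ?(ltW lamt).
apply: (@lt_le_trans _ _ (\int[P]_w (Phi t * (\1_D w)%:E))%E).
  rewrite ge0_integralZl ?integral_indic// ?setIT; last 2 first.
  - by apply/measurable_EFinP; exact: measurable_indic.
  - exact: ge0 (ltW t0).
  have phit := Phi_fin (ltW t0).
  rewrite -(fineK phit) -[X in (_ * X)%E](fineK PDfin) -EFinM lte_fin.
  by rewrite -ltr_pdivrMr// mul1r -lte_fin (fineK phit).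
apply: ae_ge0_le_integral => //.
- by move=> w _; rewrite mule_ge0// ?ge0 ?ltW// lee_fin indicE.
- apply: emeasurable_funM; first exact: measurable_cst.
  by apply/measurable_EFinP; exact: measurable_indic.
- by move=> w _; apply: ge0; rewrite mulr_ge0 ?invr_ge0 ?(ltW lam0).
- by apply: measurable_gauge_abs => //; rewrite invr_ge0 ltW.
apply: ae_mp indE _; apply: aeW => w -> _; rewrite indicE.
case: (_ \in _); first by rewrite normr1 mulr1 mule1; apply: nd => //; exact: ltW.
by rewrite mule0 normr0 mulr0 (young0 young).
Qed.

End luxemburg.

(** * The Orlicz norm *)

Section orlicz_norm.
Context d (T : measurableType d) (R : realType) (P : probability T R).
Context (Phi : R -> \bar R) (young : young_function Phi).
Hypothesis Phi_fin : forall t : R, 0 <= t -> Phi t \is a fin_num.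
Implicit Types xi eta : realL0 P.
Let Psi := young_conjugate Phi.
Let Psi_nd (s t : R) : 0 <= s -> s <= t -> (Psi s <= Psi t)%E.
Proof. by move=> _; exact: conjugate_nd. Qed.
Let Psi_ge0 (t : R) : 0 <= t -> (0 <= Psi t)%E.
Proof. by move=> _; exact: conjugate_ge0. Qed.

Definition dual_ball : set (realL0 P) :=
  [set eta | orlicz_space P Psi eta /\ (luxemburg_norm P Psi eta <= 1)%E].

Definition pairing xi eta : \bar R := (\int[P]_w (`|xi w| * `|eta w|)%:E)%E.

Lemma measurable_pairing xi eta :
  measurable_fun setT (fun w => (`|xi w| * `|eta w|)%:E).
Proof.
by apply/measurable_EFinP; apply: measurable_funM; exact: measurable_abs.
Qed.

(** Multiplying eta by the sign of xi keeps it in the ball, so the pairings may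
be taken with moduli.  The norm becomes a supremum of integrals of nonnegative
functions, for which no integrability has to be checked. *)
Lemma orlicz_norm_pairing xi :
  orlicz_norm P Phi xi = ereal_sup [set pairing xi eta | eta in dual_ball].
Proof.
apply/eqP; rewrite eq_le; apply/andP; split.
  apply: ge_ereal_sup => _ [eta Beta <-].
  apply: (@le_trans _ _ (pairing xi eta)); last first.
    by apply: ereal_sup_ubound; exists eta.
  apply: le_trans (le_abse_integral _ _ _) _ => //.
    by apply/measurable_EFinP; apply: measurable_funM; exact: measurable_realL0.
  by rewrite /pairing; under [leRHS]eq_integral do rewrite -normrM.
apply: ge_ereal_sup => _ [eta [Xeta eta1] <-].
have mtw : measurable_fun setT (fun w => xi w * `|xi w|^-1 * `|eta w|).
  apply: measurable_funM; last exact: measurable_abs.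
  apply: measurable_funM; first exact: measurable_realL0.
  exact: (measurableT_comp (@measurable_invr R) (measurable_abs xi)).
(* With the convention 1 / 0 = 0, the factor xi / |xi| is the sign of xi. *)
pose tw := realL0_class P mtw; have twE := realL0_classE P mtw.
have abs_tw : \forall w \ae P, `|tw w| <= `|eta w|.
  apply: ae_mp twE _; apply: aeW => w ->; rewrite !normrM normfV !normr_id.
  by have [->|x0] := eqVneq (xi w) 0; rewrite ?normr0 ?mul0r// divff ?mul1r ?normr_eq0.
apply: le_ereal_sup_tmp; exists (`|\int[P]_w (xi w * tw w)%R%:E|)%E.
  exists tw => //; split; first exact: orlicz_space_solid abs_tw Xeta.
  exact: le_trans (luxemburg_le Psi_nd Psi_ge0 abs_tw) eta1.
rewrite (_ : (\int[P]_w (xi w * tw w)%:E)%E = pairing xi eta) ?lee_abs//.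
apply: ae_eq_integral => //.
- by apply/measurable_EFinP; apply: measurable_funM; exact: measurable_realL0.
- exact: measurable_pairing.
apply: ae_mp twE _; apply: aeW => w -> _; congr (_%:E).
have [->|x0] := eqVneq (xi w) 0; first by rewrite !mul0r normr0 mul0r.
rewrite !mulrA; congr (_ * _); rewrite -expr2 -real_normK ?num_real// expr2.
by rewrite mulfK// normr_eq0.
Qed.

Lemma pairing_ge0 xi eta : (0 <= pairing xi eta)%E.
Proof. by apply: integral_ge0 => w _; rewrite lee_fin mulr_ge0. Qed.

Lemma pairing_le_norm xi eta : dual_ball eta ->
  (pairing xi eta <= orlicz_norm P Phi xi)%E.
Proof.
by move=> Beta; rewrite orlicz_norm_pairing; apply: ereal_sup_ubound; exists eta.
Qed.

(** These elements test the norm of indicators, and they show that the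
supremum defining the Orlicz norm is over a nonempty set. *)
Lemma dual_ball_indic : exists2 a : R, 0 < a &
  forall D (mD : measurable D), dual_ball (a *: realL0_indic P mD).
Proof.
have [a a0 Psia] := conjugate_small young Phi_fin; exists a => // D mD.
have le1 : (\int[P]_w Psi (1^-1 * `|(a *: realL0_indic P mD : realL0 P) w|)%R <= 1)%E.
  rewrite invr1 [leRHS](_ : _ = (1 * P setT)%E); last first.
    by rewrite mul1e; exact/esym/probability_setT.
  rewrite -integral_cst//.
  apply: ae_ge0_le_integral => //.
  - by move=> w _; apply: Psi_ge0; rewrite mulr_ge0.
  - exact: measurable_gauge_abs.
  apply: ae_mp (realL0_scaleE a (realL0_indic P mD)) _.
  apply: ae_mp (realL0_indicE P mD) _; apply: aeW => w -> -> _.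
  apply: le_trans Psia; apply: Psi_nd; first by rewrite mulr_ge0.
  rewrite mul1r indicE; case: (_ \in _); rewrite ?mulr1 ?mulr0 ?normr0 ?(ltW a0)//.
  by rewrite gtr0_norm.
split; last exact: luxemburg_le_of_integral.
exists 1 => //; rewrite invr1 in le1; by apply: le_lt_trans le1 _; rewrite ltry.
Qed.

(** The Young inequality applied to c |xi| and |eta| / 2.  The factor 2 is there
because a Luxemburg norm at most 1 need not be attained, but yields an
admissible scale below 2. *)
Lemma orlicz_norm_fin xi : orlicz_space P Phi xi -> (orlicz_norm P Phi xi < +oo)%E.
Proof.
move=> [c c0 fin]; pose M := (\int[P]_w Phi (c * `|xi w|)%R)%E.
apply: (@le_lt_trans _ _ ((2 / c)%:E * (M + 1))%E); last first.
  apply: lte_mul_pinfty; rewrite ?lee_fin ?divr_ge0 ?(ltW c0)//.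
  by apply: lte_add_pinfty => //; rewrite ltry.
have Phi_ge0 := young_ge0 young; have Phi_nd := young_nd young.
rewrite orlicz_norm_pairing; apply: ge_ereal_sup => _ [eta [_ eta1] <-].
have : (luxemburg_norm P Psi eta < 2%:E)%E.
  by apply: le_lt_trans eta1 _; rewrite lte_fin ltrDl.
move=> /(luxemburg_lt)[mu [mu0 mu2] mu1]; rewrite lte_fin in mu2.
have half : (\int[P]_w Psi (2^-1 * `|eta w|)%R <= 1)%E.
  apply: le_trans mu1; apply: gauge_integral_le; rewrite ?invr_ge0 ?(ltW mu0)//.
  by apply: aeW => w; rewrite ler_wpM2r// ler_pV2 ?inE ?unitfE ?gt_eqF//= ltW.
have m1 : measurable_fun setT (fun w => Phi (c * `|xi w|)).
  by apply: measurable_gauge_abs => //; exact: ltW.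
have m2 : measurable_fun setT (fun w => Psi (2^-1 * `|eta w|)).
  exact: measurable_gauge_abs.
have p1 w : (0 <= Phi (c * `|xi w|)%R)%E by apply: Phi_ge0; rewrite mulr_ge0 ?(ltW c0).
have p2 w : (0 <= Psi (2^-1 * `|eta w|)%R)%E by apply: Psi_ge0; rewrite mulr_ge0.
have k0 : (0 <= (2 / c)%:E)%E by rewrite lee_fin divr_ge0 ?(ltW c0).
apply: (@le_trans _ _ ((2 / c)%:E *
    (M + \int[P]_w Psi (2^-1 * `|eta w|)%R))%E); last first.
  by apply: lee_wpmul2l => //; exact: leeD.
rewrite /M -ge0_integralD// -ge0_integralZl//; last 2 first.
- exact: emeasurable_funD.
- by move=> w _; rewrite adde_ge0.
apply: ge0_le_integral => //.
- exact: measurable_pairing.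
- by apply: emeasurable_funM; [exact: measurable_cst|exact: emeasurable_funD].
move=> w _; rewrite (_ : `|xi w| * `|eta w| =
  2 / c * ((c * `|xi w|) * (2^-1 * `|eta w|))).
  rewrite EFinM; apply: lee_wpmul2l => //; apply: young_inequality => //.
  by rewrite mulr_ge0 ?(ltW c0).
by field; rewrite gt_eqF.
Qed.

Lemma orlicz_function_norm :
  function_norm (orlicz_space P Phi) (orlicz_norm P Phi).
Proof.
have lux := luxemburg_function_norm P young Phi_fin.
have [a a0 ball] := dual_ball_indic.
split.
- move=> xi; apply: le_trans (pairing_le_norm xi (ball _ (@measurable0 _ T))).
  exact: pairing_ge0.
- move=> xi eta h; rewrite [leLHS]orlicz_norm_pairing.
  apply: ge_ereal_sup => _ [zeta Bz <-]; apply: le_trans (pairing_le_norm eta Bz).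
  apply: ae_ge0_le_integral => //; try exact: measurable_pairing.
  by apply: ae_mp h _; apply: aeW => w le _; rewrite lee_fin ler_wpM2r.
- move=> xi eta; rewrite [leLHS]orlicz_norm_pairing.
  apply: ge_ereal_sup => _ [zeta Bz <-].
  apply: le_trans (leeD (pairing_le_norm xi Bz) (pairing_le_norm eta Bz)).
  have mxz := measurable_pairing xi zeta; have mez := measurable_pairing eta zeta.
  rewrite /pairing -ge0_integralD//.
  apply: ae_ge0_le_integral => //.
  + exact: measurable_pairing.
  + by move=> w _; rewrite -EFinD lee_fin addr_ge0// mulr_ge0.
  + exact: emeasurable_funD.
  apply: ae_mp (realL0_addE xi eta) _; apply: aeW => w -> _.
  by rewrite -EFinD lee_fin -mulrDl ler_wpM2r// ler_normD.
- move=> b xi b0; rewrite [leLHS]orlicz_norm_pairing.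
  apply: ge_ereal_sup => _ [zeta Bz <-].
  have b0' : (0 <= b%:E)%E by rewrite lee_fin ltW.
  apply: le_trans (lee_wpmul2l b0' (pairing_le_norm xi Bz)).
  rewrite /pairing -ge0_integralZl//; last exact: measurable_pairing.
  apply: ae_ge0_le_integral => //.
  + exact: measurable_pairing.
  + by move=> w _; rewrite -EFinM lee_fin mulr_ge0 ?(ltW b0)// mulr_ge0.
  + by apply: emeasurable_funM; [exact: measurable_cst|exact: measurable_pairing].
  apply: ae_mp (realL0_scaleE b xi) _; apply: aeW => w -> _.
  by rewrite -EFinM lee_fin normrM (gtr0_norm b0) mulrA.
- exact: orlicz_norm_fin.
- exact: (fnorm_solid lux).
- exact: (fnorm_spaceD lux).
- exact: (fnorm_spaceZ lux).
move=> D mD PD; have [XD _] := fnorm_indic lux mD PD; split => //.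
apply: lt_le_trans (pairing_le_norm _ (ball D mD)).
apply: (@lt_le_trans _ _ (\int[P]_w (a%:E * (\1_D w)%:E))%E).
  rewrite ge0_integralZl ?integral_indic// ?setIT; last 2 first.
  - by apply/measurable_EFinP; exact: measurable_indic.
  - by rewrite lee_fin ltW.
  by rewrite mule_gt0.
apply: ae_ge0_le_integral => //.
- by move=> w _; rewrite -EFinM lee_fin mulr_ge0 ?(ltW a0)// indicE.
- apply: emeasurable_funM; first exact: measurable_cst.
  by apply/measurable_EFinP; exact: measurable_indic.
- exact: measurable_pairing.
apply: ae_mp (realL0_scaleE a (realL0_indic P mD)) _.
apply: ae_mp (realL0_indicE P mD) _; apply: aeW => w -> -> _.
rewrite -EFinM lee_fin indicE; case: (_ \in _); rewrite ?mulr1 ?mulr0 ?normr0 ?mulr0//.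
by rewrite normr1 mul1r ler_norm.
Qed.

End orlicz_norm.

(** * Uniform convexity of Orlicz modules *)

Theorem theorem5p2 (d : measure_display) (T : measurableType d) (R : realType)
    (P : probability T R) (k : scalar_kind) (E : rnModType P k)
    (Phi : R -> \bar R) (nrm : realL0 P -> \bar R)
    (E_complete : rn_complete E) (E_full : full_support E)
    (Phi_young : young_function Phi)
    (Phi_real : forall t : R, 0 <= t -> Phi t \is a fin_num)
    (nrm_luxemburg_or_orlicz :
      nrm = luxemburg_norm P Phi \/ nrm = orlicz_norm P Phi) :
  @uniformly_convex R (scalar_field R k) (restrict_scalars E)
    (orlicz_module E Phi) (induced_norm E nrm)
  <->
  @uniformly_convex R R (realL0 P) (orlicz_space P Phi) nrm /\
  random_uniformly_convex E.
Proof.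
have fnN : function_norm (orlicz_space P Phi) nrm.
  by case: nrm_luxemburg_or_orlicz => ->;
    [exact: luxemburg_function_norm|exact: orlicz_function_norm].
split=> [uc|[]]; last exact: uniformly_convex_module.
have [x0 x01] := exists_unit_norm E_complete E_full.
split; first exact: uniformly_convex_space_of_module x01 uc.
exact: random_uniformly_convex_of_module uc.
Qed.
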